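(* Let $n\ge 1$, let $a_k, b_k, c_k$, $k=1,\dots,n$, be real numbers with $b_k\neq 0$ for every $k$, and let $\alpha\in(-\infty,-1/2]$. If the function $f:\mathbb{R}\to\mathbb{R}$, $$f(x)=\sum_{k=1}^{n}c_{k}\bigl[(x-a_{k})^{2}+b_{k}^{2}\bigr]^{\alpha},$$ is not identically zero, then it has no more than $2(n-1)$ distinct real roots on $\mathbb{R}$. *)

(* Defs.v *)
From HB Require Import structures.
From mathcomp Require Import all_boot all_order all_algebra.
From mathcomp Require Import all_classical all_reals all_analysis.

Set Implicit Arguments.
Unset Strict Implicit.
Unset Printing Implicit Defensive.

Import Order.TTheory GRing.Theory Num.Theory.
Local Open Scope ring_scope.

(* When every [b k] is nonzero the base is positive, so [powR] is the usual
   real power (its convention [0 `^ r = 0] for [r != 0] plays no role). *)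
Definition quadratic_power_sum (R : realType) (n : nat) (a b c : 'I_n -> R)
    (alpha : R) (x : R) : R :=
  \sum_(k < n) c k * ((x - a k) ^+ 2 + b k ^+ 2) `^ alpha.

(* Main.v *)
Require Import Defs.
From HB Require Import structures.
From mathcomp Require Import all_boot all_order all_algebra.
From mathcomp Require Import all_classical all_reals all_analysis.
From mathcomp Require Import zify ring lra.

Set Implicit Arguments.
Unset Strict Implicit.
Unset Printing Implicit Defensive.

Import Order.TTheory GRing.Theory Num.Theory.

(** Put s = - alpha, so that s >= 1/2, and place a charge c_k at the point
    (a_k, |b_k|) of the half-plane y > 0. After equal points are merged and
    null charges dropped, the charges sit at distinct points.

    Extension. Up to a factor that depends on s only, [(x - a)^2 + b^2]^(-s)
    is the value at (x, 0) of
      G(x, y) = int_0^pi sin^(2s-1) t [(x-a)^2 + y^2 + b^2 - 2yb cos t]^(-s) dt,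
    which for integral 2s is the Newtonian potential, in dimension 2s + 2,
    of a ring of centre a and radius b around the x-axis. For every s > 0 it
    satisfies G_xx + G_yy + (2s/y) G_y = 0 away from (a, b), is regular up to
    the axis, tends to 0 at infinity and to +oo at (a, b). Hence f is, up to a
    constant, the restriction to the axis of U = sum_k c_k G_k.

    Nodal domains. By the maximum principle every component of U > 0 or of
    U < 0 contains a neighbourhood of a charge of the same sign. Label each
    point p of the axis with f(p) <> 0 by a charge in its component, the same
    charge for the whole component. Labels differ across a sign change, and
    disjoint connected sets in a half-plane do not cross, so labels never show
    a pattern x y x y along the axis with x <> y. Such a sequence over n
    letters changes at most 2(n-1) times: at each change either the new letter
    appears for the first time or the old one for the last time
    ([noncrossing_changes]). So f has at most 2(n-1) sign changes
    ([distinct_charges_sign_changes]).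

    The argument is carried out on a square grid of small step h, where
    components are classes of a finite relation and non-crossing is a parity
    count ([grid_paths_meet]). On the grid U satisfies h^2 times the equation up
    to an error O(h^3 (1 + 1/y)), uniformly outside fixed squares around the charges
    ([ring_potential_consistency]); the barrier C h (x^2 + 2y) turns this into
    an exact discrete maximum principle ([discrete_sign_changes]).

    Zeros. A zero need not be a sign change. If f had N distinct zeros,
    choose points p_0, .., p_N that interlace them and where f does not
    vanish; they exist because f cannot vanish on an interval
    ([combination_unique_continuation]). Replacing one coefficient c_k by
    c_k - eps and by c_k + eps makes f negative, respectively positive, at all
    the zeros and keeps its signs at the p_i. Around each zero, the two
    perturbed functions together change sign exactly twice, so
    2N <= 2(n-1) + 2(n-1) ([interlaced_zeros_bound]). *)

(** * Disjoint paths in a half-plane grid do not cross *)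

Definition grid_adj (u v : nat * nat) : bool :=
  ((u.1 == v.1) && ((u.2.+1 == v.2) || (v.2.+1 == u.2))) ||
  ((u.2 == v.2) && ((u.1.+1 == v.1) || (v.1.+1 == u.1))).

Lemma grid_adj_sym : symmetric grid_adj.
Proof. by move=> u v; rewrite /grid_adj; lia. Qed.

(** The edge from [u] to [u'] meets the vertical ray that starts just right of
    [v], halfway between its column and the next one, and goes up. Vertical
    edges never meet it, since their two ends lie in the same column. *)
Definition crosses (v u u' : nat * nat) : bool :=
  (v.2 < u.2) && ((u.1 <= v.1) (+) (u'.1 <= v.1)).

Fixpoint ray_parity (v u : nat * nat) (p : seq (nat * nat)) : bool :=
  if p is u' :: p' then crosses v u u' (+) ray_parity v u' p' else false.

(** A horizontal edge met by only one of the two rays would have the point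
    (x, y + 1) as an end. *)
Lemma ray_parity_up x y u p : path grid_adj u p ->
  (x, y.+1) \notin u :: p ->
  ray_parity (x, y) u p = ray_parity (x, y.+1) u p.
Proof.
elim: p u => [//|u' p IH] u /= /andP[uu' pp].
rewrite inE negb_or => /andP[nu nin]; rewrite (IH _ pp nin); congr (_ (+) _).
move: nin; rewrite inE negb_or => /andP[nu' _].
case: u u' nu nu' uu' {pp IH} => [u1 u2] [v1 v2].
by rewrite /crosses /grid_adj !xpair_eqE /=; lia.
Qed.

(** An edge is met by exactly one of the two rays when it enters or leaves the
    part of column x + 1 strictly above height y; the path cannot do so through
    the bottom (x + 1, y) of that part, and the count telescopes to its ends. *)
Lemma ray_parity_right x y u p : path grid_adj u p ->
  (x.+1, y) \notin u :: p ->
  ray_parity (x, y) u p (+) ray_parity (x.+1, y) u p =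
  ((u.1 == x.+1) && (y < u.2)) (+)
  (((last u p).1 == x.+1) && (y < (last u p).2)).
Proof.
elim: p u => [|u' p IH] u /=; first by rewrite !addbb.
move=> /andP[uu' pp].
rewrite inE negb_or => /andP[nu nin]; have := IH _ pp nin.
move: nin; rewrite inE negb_or => /andP[nu' _].
set t := last u' p => E.
rewrite addbACA E addbA; congr (_ (+) _).
case: u u' nu nu' uu' {E pp t IH} => [u1 u2] [v1 v2].
by rewrite /crosses /grid_adj !xpair_eqE /=; lia.
Qed.

(** At height 0 every edge over column j counts, so the parity only tells on
    which sides of column j the path starts and ends. *)
Lemma ray_parity_bottom j u p : path grid_adj u p -> (j, 0) \notin u :: p ->
  ray_parity (j, 0) u p = (u.1 <= j) (+) ((last u p).1 <= j).
Proof.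
elim: p u => [|u' p IH] u /=; first by rewrite addbb.
move=> /andP[uu' pp]; rewrite inE negb_or => /andP[nu nin].
rewrite (IH _ pp nin) addbA; congr (_ (+) _).
move: nin; rewrite inE negb_or => /andP[nu' _].
case: u u' nu nu' uu' {pp IH} => [u1 u2] [v1 v2].
by rewrite /crosses /grid_adj !xpair_eqE /=; lia.
Qed.

Lemma ray_parity_adj v v' u p : path grid_adj u p ->
  u.2 = 0 -> (last u p).2 = 0 -> v \notin u :: p -> v' \notin u :: p ->
  grid_adj v v' -> ray_parity v u p = ray_parity v' u p.
Proof.
move=> pp u0 l0.
have right_inv x y : (x.+1, y) \notin u :: p ->
    ray_parity (x, y) u p = ray_parity (x.+1, y) u p.
  move=> nin; move: (ray_parity_right pp nin); rewrite u0 l0 !ltn0 !andbF.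
  by case: ray_parity; case: ray_parity.
case: v v' => [x y] [x' y'] nv nv'; rewrite /grid_adj /=.
case/orP => /andP[/eqP e /orP[] /eqP e']; subst.
- by apply: ray_parity_up.
- by symmetry; apply: ray_parity_up.
- exact: right_inv.
- by symmetry; apply: right_inv.
Qed.

(** If the paths were disjoint, the ray parity with respect to [p] would be
    constant along [q]; but it is odd at column j, between the ends of [p], and
    even at column l, beyond them. *)
Lemma grid_paths_meet i j k l p q : i < j -> j < k -> k < l ->
  path grid_adj (i, 0) p -> last (i, 0) p = (k, 0) ->
  path grid_adj (j, 0) q -> last (j, 0) q = (l, 0) ->
  exists2 v, v \in (i, 0) :: p & v \in (j, 0) :: q.
Proof.
move=> ij jk kl pp lp pq lq.
have [/hasP[v vq vp]|/hasPn disj] := boolP (has (mem ((i, 0) :: p)) ((j, 0) :: q)).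
  by exists v.
suff /(_ (j, 0) q pq lq disj) H : forall u q', path grid_adj u q' ->
    last u q' = (l, 0) -> (forall v, v \in u :: q' -> v \notin (i, 0) :: p) ->
    ray_parity u (i, 0) p = ray_parity (l, 0) (i, 0) p.
  move: H; rewrite !ray_parity_bottom ?lp //=.
  - by lia.
  - by apply: disj; rewrite -lq mem_last.
  - by apply: disj; rewrite mem_head.
move=> u q'; elim: q' u => [|u' q' IH] u /=; first by move=> _ ->.
move=> /andP[uu' pq'] lq' dj.
have nu : u \notin (i, 0) :: p by apply: dj; rewrite mem_head.
have nu' : u' \notin (i, 0) :: p by apply: dj; rewrite !inE eqxx orbT.
rewrite (ray_parity_adj pp _ _ nu nu' uu') ?lp //.
by apply: IH => // v vin; apply: dj; rewrite inE vin orbT.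
Qed.

(** * Sequences without the pattern x y x y *)

(** At a change from [lam i] to [lam i.+1], either [lam i.+1] occurs for the
    first time or [lam i] for the last time, since otherwise the forbidden
    pattern appears. First occurrences other than that of [lam 0] and last
    occurrences other than that of [lam L] number at most #|I| - 1 each. *)
Lemma noncrossing_changes (I : finType) (L : nat) (lam : nat -> I) :
  (forall i j k l, i < j -> j < k -> k < l -> l < L.+1 ->
     lam i = lam k -> lam j = lam l -> lam i = lam j) ->
  \sum_(i < L) (lam i != lam i.+1) <= 2 * #|I|.-1.
Proof.
move=> nc.
(* F: the letter after position i is new; G: the letter at position i does not
   occur later. *)
pose F := [set i : 'I_L | [forall j : 'I_L, (j <= i) ==> (lam j != lam i.+1)]].
pose G := [set i : 'I_L | [forall j : 'I_L, (i <= j) ==> (lam j.+1 != lam i)]].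
have cover : \sum_(i < L) (lam i != lam i.+1) <= #|F| + #|G|.
  rewrite -!sum1_card !(big_mkcond (fun i => i \in _)) /= -big_split /=.
  apply: leq_sum => i _; rewrite !inE.
  case: (altP (lam i =P lam i.+1)) => //= ne.
  case: forallP => //= nF; case: forallP => //= nG; exfalso.
  have /existsP[j] : [exists j : 'I_L, ~~ ((j <= i) ==> (lam j != lam i.+1))].
    by rewrite -negb_forall; apply/forallP.
  rewrite negb_imply negbK => /andP[ji /eqP eji].
  have /existsP[l] : [exists l : 'I_L, ~~ ((i <= l) ==> (lam l.+1 != lam i))].
    by rewrite -negb_forall; apply/forallP.
  rewrite negb_imply negbK => /andP[il /eqP eil].
  have ji' : j < i.
    rewrite ltn_neqAle ji andbT; apply: contra ne => /eqP/val_inj e.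
    by rewrite -eji e.
  have il' : i.+1 < l.+1.
    rewrite ltnS ltn_neqAle il andbT; apply: contra ne => /eqP/val_inj e.
    by rewrite -{1}eil -e.
  have := nc j i i.+1 l.+1 ji' (ltnSn i) il' (ltn_ord l : l.+1 < L.+1) eji (esym eil).
  by move=> e; move/eqP: ne; rewrite -e eji.
have card_avoid (S : {set 'I_L}) (f : 'I_L -> I) x :
    {in S &, injective f} -> (forall i, i \in S -> f i != x) -> #|S| <= #|I|.-1.
  move=> inj av; rewrite -(card_in_imset inj) -(cardC1 x); apply: subset_leq_card.
  by apply/fintype.subsetP => y /imsetP[i iS ->]; rewrite !inE av.
case: L => [|L] in nc F G cover card_avoid *; first by rewrite big_ord0.
apply: leq_trans cover _; rewrite mul2n -addnn; apply: leq_add.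
- apply: (card_avoid F (fun i => lam i.+1) (lam 0)).
  + suff lt (i j : 'I_L.+1) : j \in F -> i < j -> lam i.+1 <> lam j.+1.
      move=> i j iF jF e; apply: val_inj => /=.
      by case: (ltngtP i j) => // [/(lt _ _ jF)|/(lt _ _ iF)]; rewrite e.
    rewrite inE => /forallP jF ij.
    have iL : i.+1 < L.+1 by apply: leq_ltn_trans ij _.
    by have /= := jF (Ordinal iL); rewrite ij /= => /eqP.
  + by move=> i; rewrite inE => /forallP/(_ ord0) /=; rewrite eq_sym.
- apply: (card_avoid G (fun i => lam i) (lam L.+1)).
  + suff lt (i j : 'I_L.+1) : i \in G -> i < j -> lam i <> lam j.
      move=> i j iF jF e; apply: val_inj => /=.
      by case: (ltngtP i j) => // [/(lt _ _ iF)|/(lt _ _ jF)]; rewrite e.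
    rewrite inE => /forallP iG; case: j => [[//|j] jL] /= ij.
    have jL' : j < L.+1 by apply: ltnW.
    by have /= := iG (Ordinal jL'); rewrite -ltnS ij /= eq_sym => /eqP.
  + move=> i; rewrite inE => /forallP/(_ ord_max) /=.
    by rewrite -ltnS ltn_ord /= eq_sym.
Qed.

(** * Components of a coloured grid *)

Section NodalComponents.
Variables (W H : nat) (S : eqType) (sg : 'I_W * 'I_H -> S).

Definition to_grid (u : 'I_W * 'I_H) : nat * nat := (val u.1, val u.2).

Lemma to_grid_inj : injective to_grid.
Proof. by case=> [u1 u2] [v1 v2] [/val_inj -> /val_inj ->]. Qed.

Definition nodal_step : rel ('I_W * 'I_H) :=
  fun u v => grid_adj (to_grid u) (to_grid v) && (sg u == sg v).

Lemma nodal_step_sym : connect_sym nodal_step.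
Proof.
by apply: sym_connect_sym => u v; rewrite /nodal_step grid_adj_sym eq_sym.
Qed.

Lemma connect_nodal_sg u v : connect nodal_step u v -> sg u = sg v.
Proof.
case/connectP=> p; elim: p u => [|w p IH] u /=; first by move=> _ ->.
by case/andP => /andP[_ /eqP ->] pp /(IH _ pp).
Qed.

Lemma nodal_crossing (a b c d : 'I_W * 'I_H) :
  a.2 = 0 :> nat -> b.2 = 0 :> nat -> c.2 = 0 :> nat -> d.2 = 0 :> nat ->
  a.1 < b.1 -> b.1 < c.1 -> c.1 < d.1 ->
  connect nodal_step a c -> connect nodal_step b d -> connect nodal_step a b.
Proof.
move=> a0 b0 c0 d0 ab bc cd /connectP[p pp lp] /connectP[q pq lq].
have map_grid u r : path nodal_step u r ->
    path grid_adj (to_grid u) [seq to_grid w | w <- r].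
  by move=> ur; rewrite path_map; apply: sub_path ur => x y /andP[].
have gridE (u : 'I_W * 'I_H) : u.2 = 0 :> nat -> to_grid u = (val u.1, 0).
  by move=> u0; congr pair.
have mem_conn u r w : path nodal_step u r -> w \in u :: r -> connect nodal_step u w.
  move=> ur win; case/splitPl: win ur => r1 r2 <-; rewrite cat_path => /andP[ur _].
  by apply/connectP; exists r1.
have [v vp vq] : exists2 v, v \in [seq to_grid w | w <- a :: p] &
                            v \in [seq to_grid w | w <- b :: q].
  rewrite /= !gridE //.
  apply: (grid_paths_meet ab bc cd); rewrite -?(gridE _ a0) -?(gridE _ b0) ?map_grid //.
  - by rewrite last_map -lp gridE.
  - by rewrite last_map -lq gridE.
case/mapP: vp => u up ->{v} in vq *; case/mapP: vq => u' uq /to_grid_inj e.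
subst u'; apply: connect_trans (mem_conn _ _ _ pp up) _.
by rewrite nodal_step_sym; apply: mem_conn pq uq.
Qed.

(** The combinatorial core: each point of the bottom row is labelled by a set
    [Sq k] that its component meets, chosen as a function of the component, so
    that equal labels mean equal components. [nodal_crossing] then rules out
    the pattern x y x y. *)
Lemma nodal_changes (I : finType) (Sq : I -> {pred 'I_W * 'I_H})
    (P : nat -> 'I_W * 'I_H) (L : nat) :
  (forall k u v, u \in Sq k -> v \in Sq k -> connect nodal_step u v) ->
  (forall i, i <= L -> (P i).2 = 0 :> nat) ->
  (forall i j, i <= j -> j <= L -> (P i).1 <= (P j).1) ->
  (forall i, i <= L -> exists k, exists2 u, u \in Sq k & connect nodal_step (P i) u) ->
  \sum_(i < L) (sg (P i) != sg (P i.+1)) <= 2 * #|I|.-1.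
Proof.
move=> Sq_conn P0 Pmono reach.
have [k0 _] := reach 0 (leq0n L).
pose touches i k := [exists u, (u \in Sq k) && connect nodal_step (P i) u].
pose lam i := odflt k0 [pick k | touches i k].
have lamP i : i <= L -> touches i (lam i).
  move=> iL; rewrite /lam; case: pickP => //= nt.
  have [k [u uS Pu]] := reach i iL.
  by move: (nt k) => /existsP[]; exists u; rewrite uS.
have lamE i j : i <= L -> j <= L -> (lam i = lam j <-> connect nodal_step (P i) (P j)).
  move=> iL jL; split => [e|cij].
    have := lamP j jL; rewrite -e; case/existsP=> v /andP[vS Pv].
    have /existsP[u /andP[uS Pu]] := lamP i iL.
    apply: connect_trans Pu _; apply: connect_trans (Sq_conn _ _ _ uS vS) _.
    by rewrite nodal_step_sym.
  congr odflt; apply: eq_pick => k; apply: eq_existsb => u; congr andb.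
  by apply: (same_connect nodal_step_sym).
apply: (@leq_trans (\sum_(i < L) (lam i != lam i.+1))).
  apply: leq_sum => i _; case: (altP (lam i =P lam i.+1)) => [/lamE e|_]; last exact: leq_b1.
  by rewrite (connect_nodal_sg (e _ _)) ?eqxx // ltnW.
apply: noncrossing_changes => i j k l ij jk kl lL eik ejl.
have [kL jL iL] : [/\ k <= L, j <= L & i <= L] by split; lia.
have col x y : x < y -> y <= L -> lam x <> lam y -> (P x).1 < (P y).1.
  move=> xy yL ne; rewrite ltn_neqAle Pmono ?(ltnW xy) // andbT.
  apply/eqP => e; apply: ne; apply/lamE => //; first by lia.
  suff -> : P x = P y by [].
  apply: to_grid_inj; rewrite /to_grid; congr pair => //.
  by apply: (etrans (P0 x _) (esym (P0 y yL))); lia.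
case: (lam i =P lam j) => // ne; apply/lamE => //.
apply: (@nodal_crossing (P i) (P j) (P k) (P l)); rewrite ?P0 //.
- exact: col.
- by apply: col; rewrite // -eik => /esym.
- by apply: col; rewrite // -eik -ejl.
- by apply/lamE.
- by apply/lamE.
Qed.

Lemma rectangle_nodal_connected (A B : pred nat) (u v : 'I_W * 'I_H) :
  (forall x y z, x <= y -> y <= z -> A x -> A z -> A y) ->
  (forall x y z, x <= y -> y <= z -> B x -> B z -> B y) ->
  (forall u v : 'I_W * 'I_H, A u.1 -> B u.2 -> A v.1 -> B v.2 -> sg u = sg v) ->
  A u.1 -> B u.2 -> A v.1 -> B v.2 -> connect nodal_step u v.
Proof.
move=> Acvx Bcvx sgc; case: u v => [u1 u2] [v1 v2] /= Au Bu Av Bv.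
have row (x x' : 'I_W) (y : 'I_H) : A x -> A x' -> B y -> x <= x' ->
    connect nodal_step (x, y) (x', y).
  move=> Ax + By; have [m] := ubnP x'; elim: m x' => // m IH x' xm Ax' xx'.
  move: xx'; rewrite leq_eqVlt => /predU1P[/val_inj -> //|xx'].
  case: x' => [[//|x'] x'W] in xm Ax' xx' *.
  have Ax'' : A x' by apply: (Acvx x x' x'.+1).
  apply: (connect_trans (IH (Ordinal (ltnW x'W)) _ _ _)) => //.
  apply: connect1; rewrite /nodal_step /grid_adj /= !eqxx orbT /=.
  by apply/eqP/sgc.
have column (x : 'I_W) (y y' : 'I_H) : A x -> B y -> B y' -> y <= y' ->
    connect nodal_step (x, y) (x, y').
  move=> Ax By; have [m] := ubnP y'; elim: m y' => // m IH y' ym By' yy'.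
  move: yy'; rewrite leq_eqVlt => /predU1P[/val_inj -> //|yy'].
  case: y' => [[//|y'] y'H] in ym By' yy' *.
  have By'' : B y' by apply: (Bcvx y y' y'.+1).
  apply: (connect_trans (IH (Ordinal (ltnW y'H)) _ _ _)) => //.
  apply: connect1; rewrite /nodal_step /grid_adj /= !eqxx /=.
  by apply/eqP/sgc.
apply: (@connect_trans _ _ (v1, u2)).
  by case: (leqP u1 v1) => [|/ltnW] ?; [|rewrite nodal_step_sym]; apply: row.
by case: (leqP u2 v2) => [|/ltnW] ?; [|rewrite nodal_step_sym]; apply: column.
Qed.

End NodalComponents.

Import numFieldNormedType.Exports.
Local Open Scope classical_set_scope.
Local Open Scope ring_scope.

(** * Derivatives, continuity and integration over [0, pi] *)

Section DerivativeRules.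
Context {R : realType}.
Implicit Types (f g : R -> R) (x a b : R).

Lemma is_derive_addf f g x a b : is_derive x 1 f a -> is_derive x 1 g b ->
  is_derive x 1 (fun t => f t + g t) (a + b).
Proof. by move=> df dg; exact: (is_deriveD df dg). Qed.

Lemma is_derive_subf f g x a b : is_derive x 1 f a -> is_derive x 1 g b ->
  is_derive x 1 (fun t => f t - g t) (a - b).
Proof. by move=> df dg; exact: (is_deriveB df dg). Qed.

Lemma is_derive_mulf f g x a b : is_derive x 1 f a -> is_derive x 1 g b ->
  is_derive x 1 (fun t => f t * g t) (a * g x + f x * b).
Proof.
move=> df dg; apply: (is_derive_eq (is_deriveM df dg)).
by rewrite addrC [g x *: _]mulrC.
Qed.

Lemma is_derive_constf (k : R) x : is_derive x 1 (fun=> k) 0.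
Proof. exact: is_derive_cst. Qed.

Lemma is_derive_idf x : is_derive x 1 (fun t : R => t) 1.
Proof. exact: is_derive_id. Qed.

Lemma is_derive_compf f g x a b : is_derive x 1 g b -> is_derive (g x) 1 f a ->
  is_derive x 1 (fun t => f (g t)) (a * b).
Proof. by move=> dg df; exact: (is_derive1_comp df dg). Qed.

Lemma is_derive_powRf f x a (p : R) : 0 < f x -> is_derive x 1 f a ->
  is_derive x 1 (fun t => f t `^ p) (p * f x `^ (p - 1) * a).
Proof. by move=> f0 df; apply: (is_derive_compf (f := fun t => t `^ p) df); exact: is_derive1_powR. Qed.

Lemma is_derive_invf f x a : (forall t, 0 < f t) -> is_derive x 1 f a ->
  is_derive x 1 (fun t => (f t)^-1) (- a / f x ^+ 2).
Proof.
move=> f0 df.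
have -> : (fun t => (f t)^-1) = (fun t => f t `^ (-1)).
  by apply/funext => z; rewrite powR_inv1 // ltW.
apply: (is_derive_eq (is_derive_powRf (-1) (f0 x) df)).
have -> : (-1 - 1 : R) = - 2%:R by ring.
by rewrite powR_invn ?ltW //; field; rewrite gt_eqF.
Qed.

Lemma is_derive_sumf (J : Type) (l : seq J) (F F' : J -> R -> R) x :
  (forall j, is_derive x 1 (F j) (F' j x)) ->
  is_derive x 1 (fun t => \sum_(j <- l) F j t) (\sum_(j <- l) F' j x).
Proof.
move=> dF; elim: l => [|j l IH].
  rewrite big_nil (_ : (fun _ => _) = fun=> 0); first exact: is_derive_constf.
  by apply/funext => t; rewrite big_nil.
rewrite big_cons (_ : (fun _ => _) = fun t => F j t + \sum_(i <- l) F i t).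
  exact: is_derive_addf.
by apply/funext => t; rewrite big_cons.
Qed.

Lemma is_derive_continuous f x a : is_derive x 1 f a -> {for x, continuous f}.
Proof. by move=> [df _]; apply: differentiable_continuous; exact/derivable1_diffP. Qed.

Lemma continuous_constf (k : R) : continuous (fun _ : R => k).
Proof. by move=> x; exact: cst_continuous. Qed.

Lemma continuous_addf f g : continuous f -> continuous g ->
  continuous (fun t => f t + g t).
Proof. by move=> cf cg x; exact: (continuousD (cf x) (cg x)). Qed.

Lemma continuous_subf f g : continuous f -> continuous g ->
  continuous (fun t => f t - g t).
Proof. by move=> cf cg x; exact: (continuousB (cf x) (cg x)). Qed.

Lemma continuous_mulf f g : continuous f -> continuous g ->
  continuous (fun t => f t * g t).
Proof. by move=> cf cg x; exact: (continuousM (cf x) (cg x)). Qed.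

Lemma continuous_scalef (k : R) f : continuous f -> continuous (fun t => k * f t).
Proof. by move=> cf; apply: continuous_mulf => //; exact: continuous_constf. Qed.

Lemma mean_value_bound f f' a b C : a <= b ->
  (forall x, a <= x <= b -> is_derive x 1 f (f' x)) ->
  (forall x, a <= x <= b -> `|f' x| <= C) -> `|f b - f a| <= C * (b - a).
Proof.
move=> ab df bf.
have [c cab ->] : exists2 c, c \in `[a, b] & f b - f a = f' c * (b - a).
  apply: MVT_segment => //.
    by move=> x; rewrite in_itv /= => /andP[ax xb]; apply: df; rewrite !ltW.
  apply: derivable_within_continuous => x; rewrite in_itv /= => xab.
  by have [] := df x xab.
rewrite normrM [`|b - a|]ger0_norm ?subr_ge0 //.
by rewrite ler_wpM2r ?subr_ge0 // bf // -in_itv.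
Qed.

End DerivativeRules.

Section Integral.
Context {R : realType}.
Implicit Types (F G : R -> R).

(** The laws below are for integrands continuous on the whole line, which makes
    integrability automatic. *)
Definition integral0pi F : R := \int[lebesgue_measure]_(t in `[0, pi]) F t.

Let integrable0pi F : continuous F ->
  (@lebesgue_measure R).-integrable `[0, pi] (EFin \o F).
Proof.
move=> cF; apply: continuous_compact_integrable; first exact: segment_compact.
exact: continuous_subspaceT.
Qed.

Lemma integral0piD F G : continuous F -> continuous G ->
  integral0pi (fun t => F t + G t) = integral0pi F + integral0pi G.
Proof. by move=> cF cG; apply: RintegralD => //; exact: integrable0pi. Qed.

Lemma integral0piB F G : continuous F -> continuous G ->
  integral0pi (fun t => F t - G t) = integral0pi F - integral0pi G.
Proof. by move=> cF cG; apply: RintegralB => //; exact: integrable0pi. Qed.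

Lemma integral0piZ k F : continuous F ->
  integral0pi (fun t => k * F t) = k * integral0pi F.
Proof. by move=> cF; apply: RintegralZl => //; exact: integrable0pi. Qed.

Lemma le_integral0pi F G : continuous F -> continuous G ->
  (forall t, 0 <= t <= pi -> F t <= G t) -> integral0pi F <= integral0pi G.
Proof.
move=> cF cG FG; apply: le_Rintegral => //; exact: integrable0pi.
Qed.

Lemma eq_integral0pi F G : F =1 G -> integral0pi F = integral0pi G.
Proof. by move=> /funext ->. Qed.

Lemma integral0pi_derive F P : continuous F -> continuous P ->
  (forall t, 0 < t < pi -> is_derive t 1 P (F t)) ->
  integral0pi F = P pi - P 0.
Proof.
move=> cF cP dP; rewrite /integral0pi /Rintegral.
suff -> : (\int[lebesgue_measure]_(t in `[0%R, pi]) (F t)%:E =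
           (P pi)%:E - (P 0)%:E)%E by [].
apply: continuous_FTC2.
- exact: pi_gt0.
- exact: continuous_subspaceT.
- split.
  + by move=> x; rewrite in_itv /= => /dP[].
  + exact/cvg_at_right_filter/cP.
  + exact/cvg_at_left_filter/cP.
- by move=> x; rewrite in_itv /= derive1E => /dP dPx; rewrite derive_val.
Qed.

Lemma integral0pi_cst k : integral0pi (fun=> k) = k * pi.
Proof.
have dP (t : R) : 0 < t < pi -> is_derive t 1 (fun t => k * t) k.
  move=> _; have := is_derive_mulf (is_derive_constf k t) (is_derive_idf t).
  by rewrite mul0r mulr1 add0r.
have -> := @integral0pi_derive (fun=> k) (fun t => k * t) _ _ dP.
- by rewrite mulr0 subr0.
- exact: cst_continuous.
- by move=> t; apply: continuousM; [exact: cst_continuous|].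
Qed.

Lemma normr_integral0pi_le F C : continuous F ->
  (forall t, 0 <= t <= pi -> `|F t| <= C) -> `|integral0pi F| <= C * pi.
Proof.
move=> cF FC; rewrite -integral0pi_cst ler_norml; apply/andP; split.
- have -> : - integral0pi (fun=> C) = integral0pi (fun=> - C).
    by rewrite !integral0pi_cst mulNr.
  apply: le_integral0pi => // [|t /FC]; first exact: cst_continuous.
  by rewrite ler_norml => /andP[].
- apply: le_integral0pi => // [|t /FC]; first exact: cst_continuous.
  by rewrite ler_norml => /andP[].
Qed.

End Integral.

(** * Taylor estimates for (q + t^2)^p *)

Section PowerCalculus.
Context {R : realType}.
Implicit Types (x t h m p q C T : R).

Lemma ler_powR_npos x m p : p <= 0 -> 0 < m -> m <= x -> x `^ p <= m `^ p.
Proof.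
move=> p0 m0 mx; have x0 := lt_le_trans m0 mx.
rewrite -[p]opprK 2!(powRN _ (- p)) lef_pV2 ?posrE ?powR_gt0 //.
by apply: ge0_ler_powR; rewrite ?oppr_ge0 // nnegrE ltW.
Qed.

Lemma continuous_powRf (f : R -> R) p : (forall t, 0 < f t) -> continuous f ->
  continuous (fun t => f t `^ p).
Proof.
move=> f0 cf t; apply: (@continuous_comp _ _ _ f (fun x => x `^ p)); first exact: cf.
exact: (is_derive_continuous (is_derive1_powR p (f0 t))).
Qed.

Lemma continuous_norm_powR p : 0 <= p -> continuous (fun x : R => `|x| `^ p).
Proof.
rewrite le_eqVlt => /predU1P[<-|p0].
  have -> : (fun x : R => `|x| `^ 0) = (fun=> 1) by apply/funext => x; rewrite powRr0.
  by move=> x; exact: cst_continuous.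
move=> x; have [->|x0] := eqVneq x 0; last first.
  apply: (@continuous_comp _ _ _ (fun x : R => `|x|) (fun x => x `^ p)).
    exact: norm_continuous.
  by apply: (is_derive_continuous (is_derive1_powR p _)); rewrite normr_gt0.
rewrite /continuous_at normr0 powR0 ?gt_eqF //.
apply/cvgrPdist_lt => e e0; near=> t.
rewrite sub0r normrN ger0_norm ?powR_ge0 //.
have -> : e = (e `^ p^-1) `^ p by rewrite -powRrM mulVf ?gt_eqF // powRr1 // ltW.
apply: gt0_ltr_powR => //; rewrite ?nnegrE ?powR_ge0 //.
near: t; have /cvgrPdist_lt := @cvg_id _ (nbhs (0 : R)).
move=> /(_ (e `^ p^-1) (powR_gt0 _ e0)); apply: filterS => t.
by rewrite sub0r normrN.
Unshelve. all: by end_near.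
Qed.

(** The mean value inequality, applied to f' and then to the remainder as a
    function of the step; the constant need not be the optimal 1/2. *)
Lemma taylor1 (f f1 f2 : R -> R) t h C : 0 <= h ->
  (forall e, 0 <= e <= h -> is_derive (t + e) 1 f (f1 (t + e))) ->
  (forall e, 0 <= e <= h -> is_derive (t + e) 1 f1 (f2 (t + e))) ->
  (forall e, 0 <= e <= h -> `|f2 (t + e)| <= C) ->
  `|f (t + h) - f t - h * f1 t| <= C * h ^+ 2.
Proof.
move=> h0 df df1 bf2.
have C0 : 0 <= C by apply: le_trans (bf2 0 _); rewrite ?normr_ge0 // lexx.
have dshift (g g' : R -> R) e : is_derive (t + e) 1 g (g' (t + e)) ->
    is_derive e 1 (fun e => g (t + e)) (g' (t + e)).
  move=> dg; have := is_derive_compf (is_derive_addf (is_derive_constf t e) (is_derive_idf e)) dg.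
  by rewrite add0r mulr1.
have b1 e : 0 <= e <= h -> `|f1 (t + e) - f1 t| <= C * h.
  move=> /andP[e0 eh]; rewrite -{2}[t]addr0.
  apply: le_trans (mean_value_bound (f := fun e => f1 (t + e)) (f' := fun e => f2 (t + e)) (C := C) e0 _ _) _.
  - by move=> x /andP[x0 xe]; apply/dshift/df1; rewrite x0 (le_trans xe).
  - by move=> x /andP[x0 xe]; apply/bf2; rewrite x0 (le_trans xe).
  - by rewrite subr0 ler_wpM2l.
have := mean_value_bound (f := fun e => f (t + e) - e * f1 t)
  (f' := fun e => f1 (t + e) - f1 t) (C := C * h) h0 _ _.
rewrite subr0 addr0 mul0r subr0 expr2 mulrA => /(_ _ _)/le_trans.
have -> : f (t + h) - f t - h * f1 t = f (t + h) - h * f1 t - f t by ring.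
apply => // x xh.
have := is_derive_subf (dshift _ _ _ (df x xh)) (is_derive_mulf (is_derive_idf x) (is_derive_constf (f1 t) x)).
by rewrite mul1r mulr0 addr0.
Qed.

(** The remainder as a function of the step e vanishes with its first derivative
    at e = 0, and its second derivative is at most 2 C e; two applications of the
    mean value inequality bring this back to the remainder. *)
Lemma taylor2 (f f1 f2 f3 : R -> R) t h C : 0 <= h ->
  (forall e, - h <= e <= h -> is_derive (t + e) 1 f (f1 (t + e))) ->
  (forall e, - h <= e <= h -> is_derive (t + e) 1 f1 (f2 (t + e))) ->
  (forall e, - h <= e <= h -> is_derive (t + e) 1 f2 (f3 (t + e))) ->
  (forall e, - h <= e <= h -> `|f3 (t + e)| <= C) ->
  `|f (t + h) + f (t - h) - 2 * f t - h ^+ 2 * f2 t| <= 2 * C * h ^+ 3.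
Proof.
move=> h0 df df1 df2 bf3.
have C0 : 0 <= C by apply: le_trans (bf3 0 _); rewrite ?normr_ge0 // oppr_le0 h0.
have dp (g g' : R -> R) e : is_derive (t + e) 1 g (g' (t + e)) ->
    is_derive e 1 (fun e => g (t + e)) (g' (t + e)).
  move=> dg; have := is_derive_compf (is_derive_addf (is_derive_constf t e) (is_derive_idf e)) dg.
  by rewrite add0r mulr1.
have dm (g g' : R -> R) e : is_derive (t - e) 1 g (g' (t - e)) ->
    is_derive e 1 (fun e => g (t - e)) (- g' (t - e)).
  move=> dg; have := is_derive_compf (is_derive_subf (is_derive_constf t e) (is_derive_idf e)) dg.
  by rewrite sub0r mulrN1.
have rng e : 0 <= e <= h -> (- h <= e <= h) /\ (- h <= - e <= h).
  by move=> /andP[? ?]; split; apply/andP; split; lra.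
have b2 e : 0 <= e <= h -> `|f2 (t + e) + f2 (t - e) - 2 * f2 t| <= 2 * C * h.
  move=> eh; case/andP: (eh) => e0 eh'.
  have -> : f2 (t + e) + f2 (t - e) - 2 * f2 t =
            (f2 (t + e) + f2 (t - e)) - (f2 (t + 0) + f2 (t - 0)).
    by rewrite addr0 subr0; ring.
  apply: le_trans (mean_value_bound (f := fun e => f2 (t + e) + f2 (t - e))
    (f' := fun e => f3 (t + e) - f3 (t - e)) (C := 2 * C) e0 _ _) _.
  - move=> x /andP[x0 xe]; have /rng[r1 r2] : 0 <= x <= h by rewrite x0 (le_trans xe).
    exact: (is_derive_addf (dp _ _ _ (df2 _ r1)) (dm _ _ _ (df2 _ r2))).
  - move=> x /andP[x0 xe]; have /rng[r1 r2] : 0 <= x <= h by rewrite x0 (le_trans xe).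
    apply: le_trans (ler_normB _ _) _; have := bf3 _ r1; have := bf3 _ r2; lra.
  - by rewrite subr0 ler_wpM2l // mulr_ge0.
have b1 e : 0 <= e <= h -> `|f1 (t + e) - f1 (t - e) - 2 * e * f2 t| <= 2 * C * h * h.
  move=> eh; case/andP: (eh) => e0 eh'.
  have -> : f1 (t + e) - f1 (t - e) - 2 * e * f2 t =
            (f1 (t + e) - f1 (t - e) - 2 * e * f2 t) - (f1 (t + 0) - f1 (t - 0) - 2 * 0 * f2 t).
    by rewrite addr0 subr0; ring.
  apply: le_trans (mean_value_bound (f := fun e => f1 (t + e) - f1 (t - e) - 2 * e * f2 t)
    (f' := fun e => f2 (t + e) + f2 (t - e) - 2 * f2 t) (C := 2 * C * h) e0 _ _) _.
  - move=> x /andP[x0 xe]; have /rng[r1 r2] : 0 <= x <= h by rewrite x0 (le_trans xe).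
    have := is_derive_subf (is_derive_subf (dp _ _ _ (df1 _ r1)) (dm _ _ _ (df1 _ r2)))
      (is_derive_mulf (is_derive_mulf (is_derive_constf 2 x) (is_derive_idf x)) (is_derive_constf (f2 t) x)).
    by rewrite opprK mul0r add0r !mulr1 mulr0 addr0.
  - by move=> x /andP[x0 xe]; apply: b2; rewrite x0 (le_trans xe).
  - by rewrite subr0 ler_wpM2l // !mulr_ge0.
have -> : f (t + h) + f (t - h) - 2 * f t - h ^+ 2 * f2 t =
   (f (t + h) + f (t - h) - h ^+ 2 * f2 t) - (f (t + 0) + f (t - 0) - 0 ^+ 2 * f2 t).
  by rewrite addr0 subr0; ring.
apply: le_trans (mean_value_bound (f := fun e => f (t + e) + f (t - e) - e ^+ 2 * f2 t)
  (f' := fun e => f1 (t + e) - f1 (t - e) - 2 * e * f2 t) (C := 2 * C * h * h) h0 _ _) _ => //.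
- move=> x xh; have [r1 r2] := rng x xh.
  have := is_derive_subf (is_derive_addf (dp _ _ _ (df _ r1)) (dm _ _ _ (df _ r2)))
      (is_derive_mulf (is_derive_mulf (is_derive_idf x) (is_derive_idf x)) (is_derive_constf (f2 t) x)).
  by move=> d; apply: (is_derive_eq d); ring.
- by rewrite le_eqVlt; apply/orP; left; apply/eqP; ring.
Qed.

(** The integrand of the ring potential depends on x, and on y, through a
    function of this form. *)
Definition qpow p q t : R := (q + t ^+ 2) `^ p.
Definition qpow1 p q t : R := 2 * p * t * qpow (p - 1) q t.
Definition qpow2 p q t : R :=
  2 * p * qpow (p - 1) q t + 4 * p * (p - 1) * t ^+ 2 * qpow (p - 2) q t.
Definition qpow3 p q t : R :=
  12 * p * (p - 1) * t * qpow (p - 2) q t +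
  8 * p * (p - 1) * (p - 2) * t ^+ 3 * qpow (p - 3) q t.

Lemma is_derive_qpow p q t : 0 < q + t ^+ 2 ->
  is_derive t 1 (qpow p q) (qpow1 p q t).
Proof.
move=> q0.
have dX : is_derive t 1 (fun t : R => q + t ^+ 2) (2 * t).
  have := is_derive_addf (is_derive_constf q t)
    (is_derive_mulf (is_derive_idf t) (is_derive_idf t)).
  by move=> d; apply: (is_derive_eq d); ring.
apply: (is_derive_eq (is_derive_powRf (f := fun t : R => q + t ^+ 2) p q0 dX)).
by rewrite /qpow1 /qpow; ring.
Qed.

Lemma is_derive_qpow1 p q t : 0 < q + t ^+ 2 ->
  is_derive t 1 (qpow1 p q) (qpow2 p q t).
Proof.
move=> q0; apply: (is_derive_eq (is_derive_mulf
  (is_derive_mulf (is_derive_constf (2 * p) t) (is_derive_idf t))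
  (is_derive_qpow (p - 1) q0))); rewrite /qpow2 /qpow1.
by rewrite (_ : p - 1 - 1 = p - 2); ring.
Qed.

Lemma is_derive_qpow2 p q t : 0 < q + t ^+ 2 ->
  is_derive t 1 (qpow2 p q) (qpow3 p q t).
Proof.
move=> q0; have d2 := is_derive_mulf (is_derive_idf t) (is_derive_idf t).
apply: (is_derive_eq (is_derive_addf
  (is_derive_mulf (is_derive_constf (2 * p) t) (is_derive_qpow (p - 1) q0))
  (is_derive_mulf (is_derive_mulf (is_derive_constf (4 * p * (p - 1)) t) d2)
    (is_derive_qpow (p - 2) q0)))); rewrite /qpow3 /qpow1.
rewrite (_ : p - 1 - 1 = p - 2); last by ring.
by rewrite (_ : p - 2 - 1 = p - 3); ring.
Qed.

Lemma qpow_derivatives_bound p m T : p <= 0 -> 0 < m -> 0 <= T ->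
  exists2 C, 0 <= C & forall q t, m <= q + t ^+ 2 -> `|t| <= T ->
    `|qpow2 p q t| <= C /\ `|qpow3 p q t| <= C.
Proof.
move=> p0 m0 T0.
pose C2 := `|2 * p| * m `^ (p - 1) + `|4 * p * (p - 1)| * T ^+ 2 * m `^ (p - 2).
pose C3 := `|12 * p * (p - 1)| * T * m `^ (p - 2) +
  `|8 * p * (p - 1) * (p - 2)| * T ^+ 3 * m `^ (p - 3).
have C20 : 0 <= C2 by rewrite addr_ge0 // !mulr_ge0 ?powR_ge0 ?exprn_ge0.
have C30 : 0 <= C3 by rewrite addr_ge0 // !mulr_ge0 ?powR_ge0 ?exprn_ge0.
exists (C2 + C3); first exact: addr_ge0.
move=> q t mq tT.
have X k : 0 <= k -> `|qpow (p - k) q t| <= m `^ (p - k).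
  move=> k0; rewrite ger0_norm ?powR_ge0 //; apply: ler_powR_npos => //; lra.
have tn k : `|t ^+ k| <= T ^+ k by rewrite normrX lerXn2r ?nnegrE.
split.
- apply: (@le_trans _ _ C2); last by rewrite lerDl.
  apply: le_trans (ler_normD _ _) _; apply: lerD; rewrite normrM.
    by apply: ler_wpM2l => //; apply: X.
  apply: ler_pM => //; last exact: X.
  by rewrite normrM ler_wpM2l.
- apply: (@le_trans _ _ C3); last by rewrite lerDr.
  apply: le_trans (ler_normD _ _) _; apply: lerD; rewrite normrM.
    apply: ler_pM => //; last exact: X.
    by rewrite normrM ler_wpM2l.
  apply: ler_pM => //; last exact: X.
  by rewrite normrM ler_wpM2l.
Qed.

End PowerCalculus.

(** * The potential of a charged ring *)

Section RingPotential.
Context {R : realType}.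
Variable s : R.
Hypothesis s_ge : 1 / 2 <= s.
Implicit Types (a b x y h t : R).

(** Squared distance from (x, y, 0) to the point (a, b cos t, b sin t) of the
    ring. *)
Definition ring_dist2 a b x y t : R := (x - a) ^+ 2 + y ^+ 2 + b ^+ 2 - 2 * y * b * cos t.
(** Density, in the angle t between the meridian half-plane and the point, of
    the uniform measure on a sphere of dimension 2s. The exponent is nonnegative
    because s >= 1/2, which makes the density bounded by 1; the absolute value
    only matters outside [0, pi] and makes it continuous on the whole line. *)
Definition ring_weight t : R := `|sin t| `^ (2 * s - 1).
Definition ring_potential a b x y : R :=
  integral0pi (fun t => ring_weight t * ring_dist2 a b x y t `^ (- s)).

Let s_gt0 : 0 < s. Proof. by move: s_ge; lra. Qed.

Lemma ring_weight_continuous : continuous ring_weight.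
Proof.
move=> t; apply: (@continuous_comp _ _ _ sin (fun x => `|x| `^ (2 * s - 1))).
  exact: continuous_sin.
by apply: continuous_norm_powR; move: s_ge; lra.
Qed.

Lemma ring_weight_ge0 t : 0 <= ring_weight t. Proof. exact: powR_ge0. Qed.

Lemma ring_weight_le1 t : ring_weight t <= 1.
Proof.
apply: (@le_trans _ _ (1 `^ (2 * s - 1))); last by rewrite powR1.
apply: ge0_ler_powR; rewrite ?nnegrE //; first by move: s_ge; lra.
exact: sin_max.
Qed.

Lemma ring_dist2E a b x y t : ring_dist2 a b x y t =
  (x - a) ^+ 2 + (b * sin t) ^+ 2 + (y - b * cos t) ^+ 2.
Proof. by rewrite /ring_dist2 exprMn sin2cos2; ring. Qed.

(** The nearest point of the ring is the one with t = 0. *)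
Lemma ring_dist2_ge a b x y t : 0 <= y -> 0 <= b ->
  (x - a) ^+ 2 + (y - b) ^+ 2 <= ring_dist2 a b x y t.
Proof.
move=> y0 b0; rewrite /ring_dist2.
have : y * b * cos t <= y * b * 1 by rewrite ler_wpM2l ?mulr_ge0 // cos_le1.
lra.
Qed.

Lemma is_derive_chord2 a b x y t :
  is_derive t 1 (ring_dist2 a b x y) (2 * y * b * sin t).
Proof.
have := is_derive_subf (is_derive_constf ((x - a) ^+ 2 + y ^+ 2 + b ^+ 2) t)
  (is_derive_mulf (is_derive_constf (2 * y * b) t) (is_derive_cos t)).
by move=> d; apply: (is_derive_eq d); ring.
Qed.

Lemma ring_dist2_continuous a b x y : continuous (ring_dist2 a b x y).
Proof. by move=> t; exact: is_derive_continuous (is_derive_chord2 a b x y t). Qed.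

Lemma ring_dist2_powR_continuous a b x y p : 0 <= y -> 0 <= b ->
  0 < (x - a) ^+ 2 + (y - b) ^+ 2 -> continuous (fun t => ring_dist2 a b x y t `^ p).
Proof.
move=> y0 b0 d0; apply: continuous_powRf; last exact: ring_dist2_continuous.
by move=> t; apply: lt_le_trans d0 _; exact: ring_dist2_ge.
Qed.

Lemma ring_integrand_continuous a b x y p : 0 <= y -> 0 <= b ->
  0 < (x - a) ^+ 2 + (y - b) ^+ 2 ->
  continuous (fun t => ring_weight t * ring_dist2 a b x y t `^ p).
Proof.
move=> y0 b0 d0; apply: continuous_mulf; first exact: ring_weight_continuous.
exact: ring_dist2_powR_continuous.
Qed.

(** On the axis all points of the ring are at the same distance. *)
Lemma ring_potential_axis a b x :
  ring_potential a b x 0 = integral0pi ring_weight * ((x - a) ^+ 2 + b ^+ 2) `^ (- s).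
Proof.
rewrite mulrC -integral0piZ; last exact: ring_weight_continuous.
apply: eq_integral0pi => t; rewrite mulrC; congr (_ `^ _ * _).
by rewrite /ring_dist2; ring.
Qed.

Lemma ring_potential_bounds a b x y d : 0 <= y -> 0 <= b -> 0 < d ->
  d ^+ 2 <= (x - a) ^+ 2 + (y - b) ^+ 2 ->
  0 <= ring_potential a b x y <= (d ^+ 2) `^ (- s) * pi.
Proof.
move=> y0 b0 d0 dxy.
have d20 : 0 < d ^+ 2 by rewrite exprn_gt0.
have pos := lt_le_trans d20 dxy.
have cF := ring_integrand_continuous (p := - s) y0 b0 pos.
apply/andP; split.
  rewrite -[0](@mul0r R pi) -integral0pi_cst; apply: le_integral0pi => //.
    exact: cst_continuous.
  by move=> t _; rewrite mulr_ge0 ?powR_ge0.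
rewrite -integral0pi_cst; apply: le_integral0pi => //; first exact: cst_continuous.
move=> t _; rewrite -[leRHS]mul1r.
apply: ler_pM; rewrite ?ring_weight_ge0 ?powR_ge0 ?ring_weight_le1 //.
apply: ler_powR_npos => //; first by rewrite oppr_le0 ltW.
exact: le_trans dxy (ring_dist2_ge _ _ _ y0 b0).
Qed.

(** The operator u_xx + u_yy + (2s/y) u_y applied to the integrand
    [ring_dist2 ^ (- s)] at a fixed angle; b sin t and b cos t are the
    coordinates of the point of the ring. *)
Definition darboux a b x y t : R :=
  qpow2 (- s) ((b * sin t) ^+ 2 + (y - b * cos t) ^+ 2) (x - a) +
  qpow2 (- s) ((x - a) ^+ 2 + (b * sin t) ^+ 2) (y - b * cos t) +
  2 * s / y * qpow1 (- s) ((x - a) ^+ 2 + (b * sin t) ^+ 2) (y - b * cos t).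

Lemma darbouxE a b x y t : y != 0 -> 0 < ring_dist2 a b x y t ->
  darboux a b x y t =
  4 * s ^+ 2 * b / y * cos t * ring_dist2 a b x y t `^ (- s - 1)
  - 4 * s * (s + 1) * b ^+ 2 * (sin t * sin t) * ring_dist2 a b x y t `^ (- s - 2).
Proof.
move=> y0 rho0; rewrite /darboux /qpow2 /qpow1 /qpow.
have -> : (b * sin t) ^+ 2 + (y - b * cos t) ^+ 2 + (x - a) ^+ 2 = ring_dist2 a b x y t.
  by rewrite ring_dist2E; ring.
rewrite -ring_dist2E.
have e1 : ring_dist2 a b x y t `^ (- s - 1) = ring_dist2 a b x y t * ring_dist2 a b x y t `^ (- s - 2).
  rewrite -[X in X * _](powRr1 (ltW rho0)) -powRD ?(gt_eqF rho0) ?implybT //.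
  by congr (_ `^ _); ring.
rewrite e1; set Z := _ `^ _; rewrite ring_dist2E.
by field.
Qed.

Let exact_form a b x y t :=
  ring_weight t * (4 * s ^+ 2 * b / y * cos t * ring_dist2 a b x y t `^ (- s - 1)
  - 4 * s * (s + 1) * b ^+ 2 * (sin t * sin t) * ring_dist2 a b x y t `^ (- s - 2)).

Let weight_darbouxE a b x y : 0 < y -> 0 <= b -> 0 < (x - a) ^+ 2 + (y - b) ^+ 2 ->
  (fun t => ring_weight t * darboux a b x y t) = exact_form a b x y.
Proof.
move=> y0 b0 d0; apply/funext => t; rewrite darbouxE ?gt_eqF //.
by apply: lt_le_trans d0 (ring_dist2_ge _ _ _ (ltW y0) b0).
Qed.

Lemma weight_darboux_continuous a b x y : 0 < y -> 0 <= b ->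
  0 < (x - a) ^+ 2 + (y - b) ^+ 2 ->
  continuous (fun t => ring_weight t * darboux a b x y t).
Proof.
move=> y0 b0 d0; rewrite weight_darbouxE //.
have cpow p := ring_dist2_powR_continuous (p := p) (ltW y0) b0 d0.
apply: continuous_mulf; first exact: ring_weight_continuous.
apply: continuous_subf; apply: continuous_mulf; try exact: cpow.
  by apply: continuous_scalef; exact: continuous_cos.
by apply: continuous_scalef; apply: continuous_mulf; exact: continuous_sin.
Qed.

Lemma norm_sin_powR_continuous p : 0 <= p -> continuous (fun t : R => `|sin t| `^ p).
Proof.
move=> p0 t; apply: (@continuous_comp _ _ _ sin (fun x => `|x| `^ p)).
  exact: continuous_sin.
exact: continuous_norm_powR.
Qed.

Lemma near_norm_sin t : 0 < t < pi -> \forall z \near t, `|sin z| = sin z :> R.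
Proof.
move=> t0pi; have sin0 := sin_gt0_pi t0pi.
have /cvgrPdist_lt /(_ _ sin0) := @continuous_sin R t.
apply: filterS => z; rewrite ltr_norml => /andP[_]; rewrite ltrBlDr ltrDl => z0.
by rewrite gtr0_norm.
Qed.

(** The weighted integrand is the derivative of
    (2sb/y) sin^(2s) t ring_dist2^(-s-1), which vanishes at 0 and at pi. This is
    why the ring potential solves the equation u_xx + u_yy + (2s/y) u_y = 0. *)
Lemma integral_darboux a b x y : 0 < y -> 0 <= b ->
  0 < (x - a) ^+ 2 + (y - b) ^+ 2 ->
  integral0pi (fun t => ring_weight t * darboux a b x y t) = 0.
Proof.
move=> y0 b0 d0.
have rho0 t : 0 < ring_dist2 a b x y t by apply: lt_le_trans d0 (ring_dist2_ge _ _ _ (ltW y0) b0).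
have cF := weight_darboux_continuous y0 b0 d0; move: cF.
rewrite weight_darbouxE //; set F := exact_form a b x y => cF.
pose P t := 2 * s * b / y * (`|sin t| `^ (2 * s) * ring_dist2 a b x y t `^ (- s - 1)).
have cP : continuous P.
  apply: continuous_scalef; apply: continuous_mulf.
    by apply: norm_sin_powR_continuous; rewrite mulr_ge0 // ltW.
  exact: (ring_dist2_powR_continuous (ltW y0) b0 d0).
have dP t : 0 < t < pi -> is_derive t 1 P (F t).
  move=> t0pi; have sin0 := sin_gt0_pi t0pi.
  (* P without the absolute value; the two agree on ]0, pi[. *)
  pose Q t := 2 * s * b / y * (sin t `^ (2 * s) * ring_dist2 a b x y t `^ (- s - 1)).
  have dQ : is_derive t 1 Q (F t).
    have := is_derive_mulf (is_derive_constf (2 * s * b / y) t) (is_derive_mulf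
      (is_derive_powRf (2 * s) sin0 (is_derive_sin t))
      (is_derive_powRf (- s - 1) (rho0 t) (is_derive_chord2 a b x y t))).
    move=> d; apply: (is_derive_eq d).
    rewrite /F /exact_form /ring_weight gtr0_norm // (_ : - s - 1 - 1 = - s - 2); last by ring.
    have -> : sin t `^ (2 * s) = sin t * sin t `^ (2 * s - 1).
      by rewrite mulr_powRB1 ?mulr_gt0 // ltW.
    by field; rewrite gt_eqF.
  apply: (near_eq_is_derive (f := Q)) => //.
  by have := near_norm_sin t0pi; apply: filterS => z; rewrite /P => ->.
rewrite (integral0pi_derive cF cP dP).
by rewrite /P sinpi sin0 normr0 powR0 ?mul0r ?mulr0 ?subr0 // gt_eqF // mulr_gt0.
Qed.

(** The y-derivative of the integrand on the axis is a multiple of cos t, so this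
    identity says that the ring potential is flat across the axis. *)
Lemma integral_weight_cos : integral0pi (fun t => ring_weight t * cos t) = 0.
Proof.
pose P t := (2 * s)^-1 * `|sin t| `^ (2 * s).
have cF : continuous (fun t => ring_weight t * cos t).
  by apply: continuous_mulf; [exact: ring_weight_continuous|exact: continuous_cos].
have cP : continuous P.
  by apply/continuous_scalef/norm_sin_powR_continuous; rewrite mulr_ge0 // ltW.
have dP t : 0 < t < pi -> is_derive t 1 P (ring_weight t * cos t).
  move=> t0pi; have sin0 := sin_gt0_pi t0pi.
  apply: (near_eq_is_derive (f := fun t => (2 * s)^-1 * sin t `^ (2 * s))) => //.
    by have := near_norm_sin t0pi; apply: filterS => z; rewrite /P => ->.
  have := is_derive_mulf (is_derive_constf (2 * s)^-1 t)
    (is_derive_powRf (2 * s) sin0 (is_derive_sin t)).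
  move=> d; apply: (is_derive_eq d); rewrite /ring_weight gtr0_norm //.
  by field; rewrite gt_eqF.
rewrite (integral0pi_derive cF cP dP).
by rewrite /P sinpi sin0 normr0 powR0 ?mul0r ?mulr0 ?subr0 // gt_eqF // mulr_gt0.
Qed.

Lemma off_square_dist (a b x y r : R) : 0 < r -> (r <= `|x - a|) || (r <= `|y - b|) ->
  r ^+ 2 <= (x - a) ^+ 2 + (y - b) ^+ 2.
Proof.
move=> r0; have sq z : r <= `|z| -> r ^+ 2 <= z ^+ 2.
  by move=> rz; rewrite -[leRHS]real_normK ?num_real // lerXn2r ?nnegrE // ltW.
by case/orP => /sq; [have := sqr_ge0 (y - b)|have := sqr_ge0 (x - a)]; lra.
Qed.

Lemma off_square_shift (u v r h e : R) : 2 * h <= r -> `|e| <= h -> r <= `|u - v| ->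
  r / 2 <= `|u + e - v|.
Proof.
move=> hr eh ru; have := ler_normB (u + e - v) e.
have -> : u + e - v - e = u - v by ring.
lra.
Qed.

Lemma qpow_second_difference r T : 0 < r -> 0 <= T -> exists2 C, 0 <= C &
  forall q tau h, 0 <= h -> (forall e, `|e| <= h -> r <= q + (tau + e) ^+ 2) ->
    (forall e, `|e| <= h -> `|tau + e| <= T) ->
  `|qpow (- s) q (tau + h) + qpow (- s) q (tau - h) - 2 * qpow (- s) q tau
     - h ^+ 2 * qpow2 (- s) q tau| <= 2 * C * h ^+ 3.
Proof.
move=> r0 T0.
have [|C C0 HC] := qpow_derivatives_bound (p := - s) _ r0 T0; first by rewrite oppr_le0 ltW.
exists C => // q tau h h0 pos bnd.
have ne e : - h <= e <= h -> `|e| <= h by rewrite ler_norml.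
have pos' e : - h <= e <= h -> 0 < q + (tau + e) ^+ 2.
  by move=> /ne/pos; apply: lt_le_trans.
apply: (@taylor2 _ (qpow (- s) q) (qpow1 (- s) q) (qpow2 (- s) q) (qpow3 (- s) q)
  tau h C h0) => e he.
- exact: is_derive_qpow (pos' e he).
- exact: is_derive_qpow1 (pos' e he).
- exact: is_derive_qpow2 (pos' e he).
- by have [|_] := HC q (tau + e) (pos e (ne e he)) _; [exact: bnd (ne e he)|].
Qed.

Lemma qpow_first_difference r T : 0 < r -> 0 <= T -> exists2 C, 0 <= C &
  forall q tau h, 0 <= h -> (forall e, 0 <= e <= h -> r <= q + (tau + e) ^+ 2) ->
    (forall e, 0 <= e <= h -> `|tau + e| <= T) ->
  `|qpow (- s) q (tau + h) - qpow (- s) q tau - h * qpow1 (- s) q tau| <= C * h ^+ 2.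
Proof.
move=> r0 T0.
have [|C C0 HC] := qpow_derivatives_bound (p := - s) _ r0 T0; first by rewrite oppr_le0 ltW.
exists C => // q tau h h0 pos bnd.
have pos' e : 0 <= e <= h -> 0 < q + (tau + e) ^+ 2.
  by move=> /pos; apply: lt_le_trans.
apply: (@taylor1 _ (qpow (- s) q) (qpow1 (- s) q) (qpow2 (- s) q) tau h C h0) => e he.
- exact: is_derive_qpow (pos' e he).
- exact: is_derive_qpow1 (pos' e he).
- by have [|] := HC q (tau + e) (pos e he) _; [exact: bnd e he|].
Qed.

(** h^2 times a discretisation of u_xx + u_yy + (2s/y) u_y. The first-order term
    is a forward difference: all four neighbours then have positive weights for
    every s, even next to the axis, as the maximum principle requires. *)
Definition discrete_darboux (u : R -> R -> R) h x y : R :=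
  u (x + h) y + u (x - h) y + u x (y + h) + u x (y - h) - 4 * u x y
  + 2 * s * h / y * (u x (y + h) - u x y).

Lemma integral0pi_stencil (F1 F2 F3 F4 F0 A : R -> R) k l :
  continuous F1 -> continuous F2 -> continuous F3 -> continuous F4 ->
  continuous F0 -> continuous A ->
  let E t := F1 t + F2 t + F3 t + F4 t - 4 * F0 t + k * (F3 t - F0 t) - l * A t in
  continuous E /\ integral0pi E =
  integral0pi F1 + integral0pi F2 + integral0pi F3 + integral0pi F4
  - 4 * integral0pi F0 + k * (integral0pi F3 - integral0pi F0) - l * integral0pi A.
Proof.
move=> c1 c2 c3 c4 c0 cA E.
have c12 := continuous_addf c1 c2; have c123 := continuous_addf c12 c3.
have c1234 := continuous_addf c123 c4; have c40 := continuous_scalef (k := 4) c0.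
have cs := continuous_subf c1234 c40.
have c30 := continuous_subf c3 c0; have ck := continuous_scalef (k := k) c30.
have csk := continuous_addf cs ck; have cl := continuous_scalef (k := l) cA.
split; first exact: continuous_subf.
by rewrite /E integral0piB // integral0piD // integral0piB // !integral0piD //
  !integral0piZ // integral0piB.
Qed.

(** Taylor expansion under the integral sign, at each angle separately; the main
    term integrates to 0 by [integral_darboux]. The factor 1 + 1/y comes from
    the coefficient 2s/y of the forward difference. *)
Lemma ring_potential_consistency a b r B : 0 <= b -> 0 < r -> 0 <= B ->
  exists2 C, 0 <= C & forall h x y, 0 < h -> 2 * h <= r -> `|x| <= B -> h <= y <= B ->
   (r <= `|x - a|) || (r <= `|y - b|) ->
   `|discrete_darboux (ring_potential a b) h x y| <= C * h ^+ 3 * (1 + y^-1).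
Proof.
move=> b0 r0 B0.
have r20 : 0 < r / 2 by rewrite divr_gt0.
have m0 : 0 < (r / 2) ^+ 2 by rewrite exprn_gt0.
pose T := B + `|a| + b + r.
have T0 : 0 <= T by rewrite !addr_ge0 // ltW.
have [C2 C20 taylor2C] := qpow_second_difference m0 T0.
have [C1 C10 taylor1C] := qpow_first_difference m0 T0.
exists ((4 * C2 + 2 * s * C1) * pi).
  by rewrite mulr_ge0 ?pi_ge0 // addr_ge0 ?mulr_ge0 // ltW.
move=> h x y h0 hr xB /andP[hy yB] far.
have y0 : 0 < y by apply: lt_le_trans hy.
have farx e : `|e| <= h -> (r / 2) ^+ 2 <= (x + e - a) ^+ 2 + (y - b) ^+ 2.
  move=> eh; apply: off_square_dist => //; case/orP: far => ?; apply/orP.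
    by left; apply: off_square_shift eh _.
  by right; lra.
have fary e : `|e| <= h -> (r / 2) ^+ 2 <= (x - a) ^+ 2 + (y + e - b) ^+ 2.
  move=> eh; apply: off_square_dist => //; case/orP: far => ?; apply/orP.
    by left; lra.
  by right; apply: off_square_shift eh _.
have ye e : `|e| <= h -> 0 <= y + e.
  by rewrite ler_norml => /andP[? _]; lra.
have farx0 e : `|e| <= h -> 0 < (x + e - a) ^+ 2 + (y - b) ^+ 2.
  by move=> /farx; apply: lt_le_trans.
have fary0 e : `|e| <= h -> 0 < (x - a) ^+ 2 + (y + e - b) ^+ 2.
  by move=> /fary; apply: lt_le_trans.
have n0 : `|0 : R| <= h by rewrite normr0 ltW.
have nh : `|h| <= h by rewrite gtr0_norm.
have nNh : `|- h| <= h by rewrite normrN gtr0_norm.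
have d0 : 0 < (x - a) ^+ 2 + (y - b) ^+ 2 by have := farx0 0 n0; rewrite addr0.
pose F u v t := ring_weight t * ring_dist2 a b u v t `^ (- s).
pose A t := ring_weight t * darboux a b x y t.
have cA : continuous A by apply: weight_darboux_continuous.
have c1 : continuous (F (x + h) y).
  by apply: ring_integrand_continuous => //; [exact: ltW|exact: farx0].
have c2 : continuous (F (x - h) y).
  by apply: ring_integrand_continuous => //; [exact: ltW|exact: farx0].
have c3 : continuous (F x (y + h)).
  by apply: ring_integrand_continuous => //; [exact: ye|exact: fary0].
have c4 : continuous (F x (y - h)).
  by apply: ring_integrand_continuous => //; [exact: ye|exact: fary0].
have c0 : continuous (F x y).
  by apply: ring_integrand_continuous => //; exact: ltW.
have [] := integral0pi_stencil (2 * s * h / y) (h ^+ 2) c1 c2 c3 c4 c0 cA.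
rewrite (integral_darboux y0 b0 d0) mulr0 subr0.
set E := (fun t => _ - h ^+ 2 * A t) => cE; rewrite -/(discrete_darboux (ring_potential a b) h x y) => <-.
rewrite [leRHS](_ : _ = (4 * C2 + 2 * s * C1) * h ^+ 3 * (1 + y^-1) * pi); last by ring.
apply: normr_integral0pi_le => // t _.
(* At the angle t, the squared distance is q1 + (x - a)^2 as a function of x and
   q2 + (y - b cos t)^2 as a function of y. *)
pose q1 := (b * sin t) ^+ 2 + (y - b * cos t) ^+ 2.
pose q2 := (x - a) ^+ 2 + (b * sin t) ^+ 2.
have R1 e : ring_dist2 a b (x + e) y t `^ (- s) = qpow (- s) q1 (x - a + e).
  by rewrite /qpow ring_dist2E /q1; congr (_ `^ _); ring.
have R2 e : ring_dist2 a b x (y + e) t `^ (- s) = qpow (- s) q2 (y - b * cos t + e).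
  by rewrite /qpow ring_dist2E /q2; congr (_ `^ _); ring.
have bcos : `|b * cos t| <= b by rewrite normrM (ger0_norm b0) ler_piMr ?cos_max.
have bnd1 e : `|e| <= h -> `|x - a + e| <= T.
  move=> eh; have := ler_normD (x - a) e; have := ler_normB x a; rewrite /T; lra.
have bnd2 e : `|e| <= h -> `|y - b * cos t + e| <= T.
  move=> eh; have := ler_normD (y - b * cos t) e; have := ler_normB y (b * cos t).
  by rewrite (gtr0_norm y0) /T; have := normr_ge0 a; lra.
have pos1 e : `|e| <= h -> (r / 2) ^+ 2 <= q1 + (x - a + e) ^+ 2.
  move=> eh; apply: le_trans (farx e eh) _; apply: le_trans (ring_dist2_ge _ _ t (ltW y0) b0) _.
  by rewrite ring_dist2E /q1 le_eqVlt; apply/orP; left; apply/eqP; ring.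
have pos2 e : `|e| <= h -> (r / 2) ^+ 2 <= q2 + (y - b * cos t + e) ^+ 2.
  move=> eh; apply: le_trans (fary e eh) _; apply: le_trans (ring_dist2_ge _ _ t (ye e eh) b0) _.
  by rewrite ring_dist2E /q2 le_eqVlt; apply/orP; left; apply/eqP; ring.
have pe e : 0 <= e <= h -> `|e| <= h by move=> /andP[? ?]; rewrite ger0_norm.
have t1 := taylor2C q1 (x - a) h (ltW h0) pos1 bnd1.
have t2 := taylor2C q2 (y - b * cos t) h (ltW h0) pos2 bnd2.
have t3 := taylor1C q2 (y - b * cos t) h (ltW h0)
  (fun e eh => pos2 e (pe e eh)) (fun e eh => bnd2 e (pe e eh)).
have Q0 : qpow (- s) q1 (x - a) = ring_dist2 a b x y t `^ (- s).
  by rewrite -[x in RHS]addr0 R1 addr0.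
have Q0' : qpow (- s) q2 (y - b * cos t) = ring_dist2 a b x y t `^ (- s).
  by rewrite -[y in RHS]addr0 R2 addr0.
move: t1 t2 t3; rewrite Q0 Q0' -!R1 -!R2.
set t1 := (X in `|X|); set t2 := (X in _ -> `|X| <= _ -> _); set t3 := (X in _ -> _ -> `|X| <= _ -> _).
move=> b1 b2 b3.
have -> : E t = ring_weight t * (t1 + t2 + 2 * s * h / y * t3).
  rewrite /E /F /A /darboux -/q1 -/q2 /t1 /t2 /t3.
  by field; rewrite gt_eqF.
rewrite normrM (ger0_norm (ring_weight_ge0 t)) -[leRHS]mul1r.
apply: ler_pM; rewrite ?ring_weight_ge0 ?ring_weight_le1 //.
have k0 : 0 <= 2 * s * h / y by rewrite !mulr_ge0 ?invr_ge0 // ltW.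
apply: (@le_trans _ _ (2 * C2 * h ^+ 3 + 2 * C2 * h ^+ 3 + 2 * s * h / y * (C1 * h ^+ 2))).
  apply: le_trans (ler_normD _ _) _; apply: lerD.
    by apply: le_trans (ler_normD _ _) _; apply: lerD.
  by rewrite normrM (ger0_norm k0) ler_wpM2l.
have h30 : 0 <= h ^+ 3 by rewrite exprn_ge0 // ltW.
have yi : 0 <= y^-1 by rewrite invr_ge0 ltW.
have p1 : 0 <= C2 * h ^+ 3 * y^-1 by apply: mulr_ge0 => //; apply: mulr_ge0.
have p2 : 0 <= s * C1 * h ^+ 3.
  by apply: mulr_ge0 => //; apply: mulr_ge0 => //; exact: ltW.
rewrite [leLHS](_ : _ = 4 * (C2 * h ^+ 3) + 2 * (s * C1 * h ^+ 3 * y^-1)); last by ring.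
rewrite [leRHS](_ : _ = 4 * (C2 * h ^+ 3) + 4 * (C2 * h ^+ 3 * y^-1) +
   2 * (s * C1 * h ^+ 3) + 2 * (s * C1 * h ^+ 3 * y^-1)); last by ring.
lra.
Qed.

(** The first-order term of the expansion integrates to 0 by
    [integral_weight_cos]. *)
Lemma ring_potential_axis_step a b r B : 0 < r -> r <= b -> 0 <= B ->
  exists2 C, 0 <= C & forall h x, 0 < h -> 2 * h <= r -> `|x| <= B ->
   `|ring_potential a b x h - ring_potential a b x 0| <= C * h ^+ 2.
Proof.
move=> r0 rb B0; have b0 : 0 <= b by apply: le_trans rb; exact: ltW.
have r20 : 0 < r / 2 by rewrite divr_gt0.
have m0 : 0 < (r / 2) ^+ 2 by rewrite exprn_gt0.
pose T := b + r; have T0 : 0 <= T by rewrite addr_ge0 // ltW.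
have [C1 C10 taylor1C] := qpow_first_difference m0 T0.
exists (C1 * pi); first by rewrite mulr_ge0 ?pi_ge0.
move=> h x h0 hr xB.
have far e : 0 <= e <= h -> (r / 2) ^+ 2 <= (x - a) ^+ 2 + (e - b) ^+ 2.
  move=> /andP[e0 eh]; apply: off_square_dist => //; apply/orP; right.
  by rewrite distrC; apply: le_trans (ler_norm _); lra.
have far0 e : 0 <= e <= h -> 0 < (x - a) ^+ 2 + (e - b) ^+ 2.
  by move=> /far; apply: lt_le_trans.
have h0h : 0 <= h <= h by rewrite lexx ltW.
have h00 : 0 <= (0 : R) <= h by rewrite lexx ltW.
pose F v t := ring_weight t * ring_dist2 a b x v t `^ (- s).
have ch : continuous (F h).
  by apply: ring_integrand_continuous => //; [exact: ltW|exact: far0].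
have c0 : continuous (F 0) by apply: ring_integrand_continuous => //; exact: far0.
have cc : continuous (fun t => ring_weight t * cos t).
  by apply: continuous_mulf; [exact: ring_weight_continuous|exact: continuous_cos].
(* k times weight times cos is the first-order term of the expansion in h. *)
pose k := h * (2 * s * b * ((x - a) ^+ 2 + b ^+ 2) `^ (- s - 1)).
have -> : ring_potential a b x h - ring_potential a b x 0 =
    integral0pi (fun t => F h t - F 0 t - k * (ring_weight t * cos t)).
  rewrite integral0piB; [|exact: continuous_subf|exact: continuous_scalef].
  by rewrite integral0piB // integral0piZ // integral_weight_cos mulr0 subr0.
rewrite [leRHS](_ : _ = C1 * h ^+ 2 * pi); last by ring.
apply: normr_integral0pi_le.
  by apply: continuous_subf; [exact: continuous_subf|exact: continuous_scalef].
move=> t _; pose q2 := (x - a) ^+ 2 + (b * sin t) ^+ 2.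
have R2 e : ring_dist2 a b x e t `^ (- s) = qpow (- s) q2 (- b * cos t + e).
  by rewrite /qpow ring_dist2E /q2; congr (_ `^ _); ring.
have bcos : `|- b * cos t| <= b by rewrite mulNr normrN normrM (ger0_norm b0) ler_piMr ?cos_max.
have bnd e : 0 <= e <= h -> `|- b * cos t + e| <= T.
  move=> /andP[e0 eh]; have := ler_normD (- b * cos t) e; rewrite (ger0_norm e0) /T; lra.
have pos e : 0 <= e <= h -> (r / 2) ^+ 2 <= q2 + (- b * cos t + e) ^+ 2.
  move=> /[dup] /andP[e0 _] eh; apply: le_trans (far e eh) _.
  apply: le_trans (ring_dist2_ge _ _ t e0 b0) _.
  by rewrite ring_dist2E /q2 le_eqVlt; apply/orP; left; apply/eqP; ring.
have Q0 : qpow (- s) q2 (- b * cos t) = ring_dist2 a b x 0 t `^ (- s).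
  by rewrite R2 addr0.
have := taylor1C q2 (- b * cos t) h (ltW h0) pos bnd; rewrite Q0 -!R2 => bt.
have -> : F h t - F 0 t - k * (ring_weight t * cos t) = ring_weight t *
    (ring_dist2 a b x h t `^ (- s) - ring_dist2 a b x 0 t `^ (- s) - h * qpow1 (- s) q2 (- b * cos t)).
  rewrite /F /k /qpow1 /qpow.
  have -> : q2 + (- b * cos t) ^+ 2 = (x - a) ^+ 2 + b ^+ 2.
    by rewrite /q2 exprMn sin2cos2; ring.
  by ring.
rewrite normrM (ger0_norm (ring_weight_ge0 t)) -[leRHS]mul1r.
by apply: ler_pM; rewrite ?ring_weight_ge0 ?ring_weight_le1.
Qed.

End RingPotential.

(** * Divergence of the ring potential at the charge *)

Section Blowup.
Context {R : realType}.
Variable s : R.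
Hypothesis s_ge : 1 / 2 <= s.
Implicit Types (a b x y t : R).

Let s_gt0 : 0 < s. Proof. by move: s_ge; lra. Qed.

(** sin t = t cos c for some c between 0 and t. *)
Lemma sin_ge_mul_cos1 t : 0 <= t <= 1 -> t * cos 1 <= sin t.
Proof.
move=> /andP[t0 t1].
have [c] : exists2 c, c \in `[0, t] & sin t - sin 0 = cos c * (t - 0).
  apply: MVT_segment => //; apply: continuous_subspaceT; exact: continuous_sin.
rewrite in_itv /= sin0 !subr0 => /andP[c0 ct] ->; rewrite mulrC ler_wpM2r //.
have pi1 : (1 : R) <= pi by rewrite (le_trans _ (@pi_ge2 R)) // ler1n.
have c1 := le_trans ct t1.
have [->//|cn1] := eqVneq c 1; apply/ltW; rewrite ltr_cos ?lt_neqAle ?cn1 //.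
- by rewrite in_itv /= c0 (le_trans c1).
- by rewrite in_itv /= ler01.
Qed.

Lemma onem_cos_le t : 0 <= t -> 1 - cos t <= t ^+ 2.
Proof.
move=> t0; have sinb (c : R) : 0 <= c -> `|sin c| <= c.
  move=> c0; have := mean_value_bound (f := sin) (f' := cos) (C := 1) c0 _ _.
  by rewrite sin0 !subr0 mul1r; apply => x _ //; exact: cos_max.
have := mean_value_bound (f := cos) (f' := fun x => - sin x) (C := t) t0 _ _.
rewrite cos0 subr0 -expr2 distrC => H; apply: le_trans (ler_norm _) _.
apply: H => x /andP[x0 xt] //; rewrite normrN; apply: le_trans xt; exact: sinb.
Qed.

(** Behaves like 1/t for d << t << 1, is at most 0 for t <= d and for t >= 1,
    and has an elementary primitive, which gives a divergence of order - ln d. *)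
Let minorant d t : R := t / (d ^+ 2 + t ^+ 2) - 2 * d ^+ 2 * t / (d ^+ 2 + t ^+ 2) ^+ 2 - t.
Let primitive d t : R :=
  2^-1 * ln (d ^+ 2 + t ^+ 2) + d ^+ 2 * (d ^+ 2 + t ^+ 2)^-1 - 2^-1 * t ^+ 2.

Let is_derive_primitive d t : 0 < d -> is_derive t 1 (primitive d) (minorant d t).
Proof.
move=> d0.
have q0 : 0 < d ^+ 2 + t ^+ 2 by rewrite ltr_pwDl ?exprn_gt0 ?sqr_ge0.
have dsq : is_derive t 1 (fun t : R => t ^+ 2) (2 * t).
  have d2 := is_derive_mulf (is_derive_idf t) (is_derive_idf t).
  by apply: (is_derive_eq d2); ring.
have dq : is_derive t 1 (fun t : R => d ^+ 2 + t ^+ 2) (2 * t).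
  by have d2 := is_derive_addf (is_derive_constf (d ^+ 2) t) dsq; apply: (is_derive_eq d2); ring.
have dln := is_derive_compf (f := @ln R) dq (is_derive1_ln q0).
have dinv : is_derive t 1 (fun t : R => (d ^+ 2 + t ^+ 2)^-1) (- (2 * t) / (d ^+ 2 + t ^+ 2) ^+ 2).
  have d2 := is_derive_invf (f := fun t : R => d ^+ 2 + t ^+ 2) _ dq.
  by apply: d2 => z; rewrite ltr_pwDl ?exprn_gt0 ?sqr_ge0.
have dp := is_derive_subf (is_derive_addf (is_derive_mulf (is_derive_constf 2^-1 t) dln)
  (is_derive_mulf (is_derive_constf (d ^+ 2) t) dinv)) (is_derive_mulf (is_derive_constf 2^-1 t) dsq).
by apply: (is_derive_eq dp); rewrite /minorant; field; rewrite gt_eqF.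
Qed.

Let minorant_continuous d : 0 < d -> continuous (minorant d).
Proof.
move=> d0.
have q0 t : 0 < d ^+ 2 + t ^+ 2 by rewrite ltr_pwDl ?exprn_gt0 ?sqr_ge0.
have cid : continuous (fun t : R => t) by move=> t; exact: cvg_id.
have csq : continuous (fun t : R => t ^+ 2) by exact: (continuous_mulf cid cid).
have cq : continuous (fun t : R => (d ^+ 2 + t ^+ 2)^-1).
  have -> : (fun t : R => (d ^+ 2 + t ^+ 2)^-1) = (fun t => (d ^+ 2 + t ^+ 2) `^ (-1)).
    by apply/funext => z; rewrite powR_inv1 // ltW.
  apply: continuous_powRf => //; apply: continuous_addf csq; exact: continuous_constf.
have -> : minorant d = fun t => t * (d ^+ 2 + t ^+ 2)^-1 -
    2 * d ^+ 2 * t * ((d ^+ 2 + t ^+ 2)^-1 * (d ^+ 2 + t ^+ 2)^-1) - t.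
  by apply/funext => t; rewrite /minorant expr2 invfM.
apply: continuous_subf => //; apply: continuous_subf; apply: continuous_mulf => //.
- exact: continuous_scalef.
- exact: continuous_mulf.
Qed.

(** At distance about b d from the charge, the integrand is at least a constant
    times 1/t for d <= t <= 1: the weight is of order t^(2s-1) and the squared
    distance of order t^2. So the integral grows at least like - ln d. *)
Lemma ring_potential_blowup a b K : 0 < b ->
  exists2 r, 0 < r & forall x y, `|x - a| <= r -> `|y - b| <= r ->
    0 < (x - a) ^+ 2 + (y - b) ^+ 2 -> K <= ring_potential s a b x y.
Proof.
move=> b0.
have c1 := @cos1_gt0 R.
pose c := cos 1 `^ (2 * s - 1) * (8 * b ^+ 2) `^ (- s).
have cp : 0 < c by rewrite mulr_gt0 ?powR_gt0 ?mulr_gt0 ?exprn_gt0.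
(* The integral of the minorant is at least - ln d - 1 - pi^2 / 2, and
   - ln d = M. *)
pose M := `|K| / c + 1 + 2^-1 * pi ^+ 2.
have M0 : 0 <= M by rewrite !addr_ge0 ?mulr_ge0 ?invr_ge0 ?exprn_ge0 ?pi_ge0 // ltW.
pose d : R := expR (- M).
have d0 : 0 < d by exact: expR_gt0.
have d1 : d <= 1 by rewrite -expR0 ler_expR oppr_le0.
exists (b * d); first by rewrite mulr_gt0.
move=> x y xa yb far.
have bdb : b * d <= b by rewrite ler_piMr // ltW.
have [y0 y2b] : 0 <= y /\ y <= 2 * b.
  by move: yb; rewrite ler_norml => /andP[? ?]; split; lra.
have q0 t : 0 < d ^+ 2 + t ^+ 2 by rewrite ltr_pwDl ?exprn_gt0 ?sqr_ge0.
apply: (@le_trans _ _ (integral0pi (fun t => c * minorant d t))); last first.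
  apply: le_integral0pi.
  - exact/continuous_scalef/minorant_continuous.
  - by apply: ring_integrand_continuous => //; exact: ltW.
  move=> t /andP[t0 tpi].
  have minE : minorant d t = t * (t ^+ 2 - d ^+ 2) / (d ^+ 2 + t ^+ 2) ^+ 2 - t.
    by rewrite /minorant; field; rewrite gt_eqF.
  have [td|dt] := leP t d.
    apply: (@le_trans _ _ 0); last by rewrite mulr_ge0 ?powR_ge0.
    rewrite pmulr_rle0 // minE subr_le0; apply: (@le_trans _ _ 0) => //.
    rewrite pmulr_lle0 ?invr_gt0 ?exprn_gt0 // mulr_ge0_le0 // subr_le0.
    by rewrite lerXn2r ?nnegrE // ltW.
  have t0' : 0 < t by exact: lt_trans dt.
  have minle : minorant d t <= t^-1 - t.
    rewrite minE lerD2r ler_pdivrMr ?exprn_gt0 // ler_pdivlMl //.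
    rewrite mulrA -expr2 -subr_ge0.
    have -> : (d ^+ 2 + t ^+ 2) ^+ 2 - t ^+ 2 * (t ^+ 2 - d ^+ 2) =
       d ^+ 2 * d ^+ 2 + 3 * (d ^+ 2 * t ^+ 2) by ring.
    by have := mulr_ge0 (sqr_ge0 d) (sqr_ge0 d); have := mulr_ge0 (sqr_ge0 d) (sqr_ge0 t); lra.
  have [t1|t1] := leP 1 t.
    apply: (@le_trans _ _ 0); last by rewrite mulr_ge0 ?powR_ge0.
    rewrite pmulr_rle0 //; apply: le_trans minle _; rewrite subr_le0.
    by apply: (@le_trans _ _ 1) => //; rewrite invf_le1.
  apply: (@le_trans _ _ (c * t^-1)).
    by rewrite ler_pM2l //; apply: le_trans minle _; rewrite gerBl.
  have t01 : 0 <= t <= 1 by rewrite t0 ltW.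
  have rho_le : ring_dist2 a b x y t <= 8 * b ^+ 2 * t ^+ 2.
    have -> : ring_dist2 a b x y t = (x - a) ^+ 2 + (y - b) ^+ 2 + 2 * (y * b) * (1 - cos t).
      by rewrite /ring_dist2; ring.
    have h1 : 2 * (y * b) * (1 - cos t) <= 2 * (2 * b * b) * t ^+ 2.
      apply: ler_pM; rewrite ?subr_ge0 ?cos_le1 ?onem_cos_le //.
        by rewrite !mulr_ge0 // ltW.
      by rewrite ler_pM2l // ler_pM2r.
    have sq z : `|z| <= b * d -> z ^+ 2 <= b ^+ 2 * t ^+ 2.
      move=> zb; rewrite -[leLHS]real_normK ?num_real // -exprMn lerXn2r ?nnegrE //.
        by rewrite mulr_ge0 // ltW.
      by apply: le_trans zb _; rewrite ler_pM2l // ltW.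
    have := sq _ xa; have := sq _ yb.
    have : 0 <= b ^+ 2 * t ^+ 2 by rewrite mulr_ge0 ?sqr_ge0.
    have e4 : 2 * (2 * b * b) * t ^+ 2 = 4 * (b ^+ 2 * t ^+ 2) by ring.
    rewrite e4 in h1.
    rewrite -[8 * b ^+ 2 * t ^+ 2]mulrA; lra.
  have rho0 : 0 < ring_dist2 a b x y t.
    by apply: lt_le_trans far (ring_dist2_ge _ _ _ y0 (ltW b0)).
  have -> : c * t^-1 = (t * cos 1) `^ (2 * s - 1) * (8 * b ^+ 2 * t ^+ 2) `^ (- s).
    have b8 : 0 <= 8 * b ^+ 2 by rewrite mulr_ge0 // sqr_ge0.
    rewrite /c (@powRM _ t (cos 1)) ?(ltW c1) // (@powRM _ (8 * b ^+ 2)) ?sqr_ge0 //.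
    rewrite -[t ^+ 2]powR_mulrn // -powRrM.
    have -> : t^-1 = t `^ (2 * s - 1) * t `^ (2%:R * - s).
      rewrite -powRD; last by rewrite (gt_eqF t0') implybT.
      by rewrite -powR_inv1 //; congr (_ `^ _); ring.
    by ring.
  apply: ler_pM; rewrite ?powR_ge0 //.
    have st : t * cos 1 <= sin t by exact: sin_ge_mul_cos1.
    have tc : 0 <= t * cos 1 by rewrite mulr_ge0 // ltW.
    rewrite /ring_weight ger0_norm ?(le_trans tc st) //.
    by apply: ge0_ler_powR; rewrite ?nnegrE ?(le_trans tc st) //; move: s_ge; lra.
  by apply: ler_powR_npos => //; rewrite oppr_le0 ltW.
have cm := minorant_continuous d0.
have cP : continuous (primitive d).
  by move=> t; exact: is_derive_continuous (is_derive_primitive t d0).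
have dP t : 0 < t < pi -> is_derive t 1 (primitive d) (minorant d t).
  by move=> _; exact: is_derive_primitive.
rewrite integral0piZ // (integral0pi_derive cm cP dP).
rewrite /primitive expr0n /= addr0 mulr0 subr0 mulfV ?gt_eqF ?exprn_gt0 //.
have -> : ln (d ^+ 2) = - 2 * M.
  by rewrite lnXn // /d expRK; ring.
apply: (@le_trans _ _ `|K|); first exact: ler_norm.
rewrite -ler_pdivrMl // mulrC.
have l0 : 0 <= ln (d ^+ 2 + pi ^+ 2).
  rewrite ln_ge0 //; have := @pi_ge2 R; have := sqr_ge0 d.
  have : (2 : R) ^+ 2 <= pi ^+ 2 by rewrite lerXn2r ?nnegrE ?pi_ge0 ?pi_ge2.
  by rewrite expr2; lra.
have f0 : 0 <= d ^+ 2 / (d ^+ 2 + pi ^+ 2) by rewrite divr_ge0 ?sqr_ge0 // ltW.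
rewrite /M; lra.
Qed.

End Blowup.

(** * Sign changes of a discrete potential along the axis *)

Section DiscreteNodalTheorem.
Context {R : realType}.
Variables (s : R) (I : finType) (a b : I -> R) (e : I -> bool) (U : R -> R -> R).
Variables (M : nat) (B h r delta C : R).
Hypothesis s_ge : 1 / 2 <= s.
Hypotheses (h_gt0 : 0 < h) (hM : h * M%:R = B) (hr : 2 * h <= r).
Hypotheses (C_gt0 : 0 < C) (barrier_small : C * h * (B ^+ 2 + 2 * B) <= delta / 2).

Let signed (t : bool) (u : R) : R := if t then u else - u.
Let on_square k x y := (`|x - a k| <= r) && (`|y - b k| <= r).

Hypothesis b_gt_r : forall k, r < b k.
Hypothesis squares_disjoint : forall j k x y, on_square j x y -> on_square k x y -> j = k.
Hypothesis axis_step : forall x, `|x| <= B -> `|U x h - U x 0| <= C * h ^+ 2.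
Hypothesis consistency : forall x y, `|x| <= B -> h <= y <= B ->
  (forall k, ~~ on_square k x y) ->
  `|discrete_darboux s U h x y| <= C * h ^+ 3 * (1 + y^-1).
Hypothesis near_sign : forall k x y, on_square k x y -> (x, y) != (a k, b k) ->
  0 < signed (e k) (U x y).
Hypothesis far_small : forall x y, 0 <= y -> (B <= `|x|) || (B <= y) -> `|U x y| <= delta / 2.

Let node := ('I_(M.*2.+1) * 'I_(M.+1))%type.
Let X (v : node) : R := - B + h * (v.1 : nat)%:R.
Let Y (v : node) : R := h * (v.2 : nat)%:R.
Let square k : {pred node} := fun v => on_square k (X v) (Y v).

(** Inside the squares the colour is prescribed, so that each square lies in one
    component whatever value [U] takes at the centre, where the potential is
    singular. *)
Let color (v : node) : option bool :=
  if [pick k | square k v] is Some k then Some (e k)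
  else if U (X v) (Y v) == 0 then None else Some (0 < U (X v) (Y v)).

Let r_gt0 : 0 < r. Proof. by move: h_gt0 hr; lra. Qed.
Let B_ge0 : 0 <= B. Proof. by rewrite -hM mulr_ge0 // ltW. Qed.
Let signed_norm t u : signed t u <= `|u|.
Proof. by case: t => /=; [|rewrite -normrN]; exact: ler_norm. Qed.

Let color_square k v : square k v -> color v = Some (e k).
Proof.
move=> vk; rewrite /color; case: pickP => [j vj|/(_ k)]; last by rewrite vk.
by rewrite (squares_disjoint vj vk).
Qed.

Let color_off v : (forall k, ~~ square k v) ->
  color v = if U (X v) (Y v) == 0 then None else Some (0 < U (X v) (Y v)).
Proof. by move=> nv; rewrite /color; case: pickP => // k; rewrite (negbTE (nv k)). Qed.

Let color_off_signed v t : (forall k, ~~ square k v) ->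
  color v = Some t <-> 0 < signed t (U (X v) (Y v)).
Proof.
move=> nv; rewrite color_off // /signed; case: (ltgtP (U (X v) (Y v)) 0) => u0.
- by case: t; split => // H; first [by rewrite oppr_gt0 | exfalso; move: H u0; lra].
- by case: t; split => // H; first [by rewrite oppr_gt0 | exfalso; move: H u0; lra].
- by rewrite u0 oppr0; split => //; case: t; rewrite ltxx.
Qed.

Let X_bound (v : node) : `|X v| <= B.
Proof.
have v2 : h * (v.1 : nat)%:R <= 2 * B.
  by rewrite -hM mulrCA -natrM ler_pM2l // ler_nat mul2n -ltnS.
have : 0 <= h * (v.1 : nat)%:R by rewrite mulr_ge0 // ltW.
move: v2; rewrite ler_norml /X => *.
by apply/andP; split; lra.
Qed.

Let Y_ge0 (v : node) : 0 <= Y v. Proof. by rewrite mulr_ge0 // ltW. Qed.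

Let Y_le (v : node) : Y v <= B.
Proof. by rewrite -hM ler_pM2l // ler_nat -ltnS. Qed.

Let adj (u v : node) := grid_adj (to_grid u) (to_grid v).

Let adj_close u v : adj u v -> `|X u - X v| <= h /\ `|Y u - Y v| <= h.
Proof.
have step (m n : nat) : m.+1 = n -> `|h * m%:R - h * n%:R| <= h.
  move=> <-; rewrite -natr1 mulrDr mulr1 opprD addrA subrr sub0r normrN.
  by rewrite gtr0_norm.
have step' (m n : nat) : n.+1 = m -> `|h * m%:R - h * n%:R| <= h.
  by rewrite distrC; exact: step.
have same (m n : nat) : m = n -> `|h * m%:R - h * n%:R| <= h.
  by move=> ->; rewrite subrr normr0 ltW.
have XE : X u - X v = h * (u.1 : nat)%:R - h * (v.1 : nat)%:R by rewrite /X; ring.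
rewrite XE /Y /adj /grid_adj /=.
by case/orP => /andP[/eqP e1 /orP[] /eqP e2]; split;
  first [exact: step | exact: step' | exact: same].
Qed.

(** The discrete operator applied to x^2 + 2y is 2 h^2 + 4 s h^2 / y, hence, as
    2s >= 1, it exceeds h^2 (1 + 1/y); the forward step of 2y on the axis is 2h.
    Scaled by C h, both dominate the discretisation errors of [U]. *)
Let barrier (x y : R) : R := C * h * (x ^+ 2 + 2 * y).

Let barrier_le (v : node) : barrier (X v) (Y v) <= delta / 2.
Proof.
apply: le_trans barrier_small; rewrite /barrier ler_pM2l ?mulr_gt0 //.
apply: lerD; last by rewrite ler_pM2l.
by rewrite -[leLHS]real_normK ?num_real // lerXn2r ?nnegrE.
Qed.

Let barrier_ge0 (v : node) : 0 <= barrier (X v) (Y v).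
Proof. by rewrite /barrier mulr_ge0 ?addr_ge0 ?sqr_ge0 ?mulr_ge0 // ltW. Qed.

(** Potential plus barrier: up to the sign [t], this is a strict discrete
    subsolution off the squares. *)
Let lifted t (v : node) := signed t (U (X v) (Y v)) + barrier (X v) (Y v).

Let right_nbr (v : node) : ((v.1 : nat) < M.*2)%N ->
  exists v', [/\ adj v v', X v' = X v + h & Y v' = Y v].
Proof.
case: v => [[i iM] j] /= im; exists (Ordinal (im : (i.+1 < M.*2.+1)%N), j).
split; first by rewrite /adj /grid_adj /= !eqxx orbT.
- by rewrite /X /= -natr1; ring.
- by [].
Qed.

Let left_nbr (v : node) : (0 < (v.1 : nat))%N ->
  exists v', [/\ adj v v', X v' = X v - h & Y v' = Y v].
Proof.
case: v => [[[//|i] iM] j] /= _; exists (Ordinal (ltnW iM), j).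
split; first by rewrite /adj /grid_adj /= !eqxx !orbT.
- by rewrite /X /= -natr1; ring.
- by [].
Qed.

Let up_nbr (v : node) : ((v.2 : nat) < M)%N ->
  exists v', [/\ adj v v', X v' = X v & Y v' = Y v + h].
Proof.
case: v => [i [j jM]] /= jm; exists (i, Ordinal (jm : (j.+1 < M.+1)%N)).
split; first by rewrite /adj /grid_adj /= !eqxx.
- by [].
- by rewrite /Y /= -natr1; ring.
Qed.

Let down_nbr (v : node) : (0 < (v.2 : nat))%N ->
  exists v', [/\ adj v v', X v' = X v & Y v' = Y v - h].
Proof.
case: v => [i [[//|j] jM]] /= _; exists (i, Ordinal (ltnW jM)).
split; first by rewrite /adj /grid_adj /= !eqxx !orbT.
- by [].
- by rewrite /Y /= -natr1; ring.
Qed.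

(** A weighted sum of the differences between the neighbours and the centre, with
    positive weights, is positive. On the axis the neighbour above suffices. *)
Let no_local_max t (v : node) : (forall k, ~~ square k v) ->
  (0 < (v.1 : nat))%N -> ((v.1 : nat) < M.*2)%N -> ((v.2 : nat) < M)%N ->
  ~ (forall v', adj v v' -> lifted t v' <= lifted t v).
Proof.
move=> nv l0 lM uM le_nbr.
have [v3 [a3 X3 Y3]] := up_nbr uM.
have := le_nbr _ a3; rewrite /lifted X3 Y3.
have [j0|j0] := posnP (v.2 : nat).
  have -> : Y v = 0 by rewrite /Y j0 mulr0.
  rewrite add0r /barrier => le3.
  have := axis_step (X_bound v); rewrite ler_norml => /andP[b1 b2].
  have : 0 < C * h ^+ 2 by rewrite mulr_gt0 ?exprn_gt0.
  move: le3; rewrite /signed => le3; suff : C * h ^+ 2 <= 0 by lra.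
  by case: t {le_nbr} le3 => /= le3; nra.
move=> le3.
have [v1 [a1 X1 Y1]] := right_nbr lM; have := le_nbr _ a1; rewrite /lifted X1 Y1 => le1.
have [v2 [a2 X2 Y2]] := left_nbr l0; have := le_nbr _ a2; rewrite /lifted X2 Y2 => le2.
have [v4 [a4 X4 Y4]] := down_nbr j0; have := le_nbr _ a4; rewrite /lifted X4 Y4 => le4.
move: le1 le2 le3 le4; set x := X v; set y := Y v => le1 le2 le3 le4.
have hy : h <= y by rewrite -[leLHS]mulr1 ler_pM2l // ler1n.
have y0 : 0 < y by apply: lt_le_trans hy.
have := consistency (X_bound v) (_ : h <= y <= B) nv.
rewrite hy Y_le => /(_ isT); rewrite -/x -/y.
pose k := 2 * s * h / y.
have k0 : 0 < k.
  by rewrite /k !mulr_gt0 ?invr_gt0 //; move: s_ge; lra.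
have kle : h / y <= k.
  by rewrite /k ler_pM2r ?invr_gt0 // ler_peMl ?(ltW h_gt0) //; move: s_ge; lra.
pose SU x y := signed t (U x y).
have dsigned : discrete_darboux s SU h x y = signed t (discrete_darboux s U h x y).
  by rewrite /discrete_darboux /SU /signed; case: (t) => //; ring.
have dsum : discrete_darboux s SU h x y + discrete_darboux s barrier h x y =
   ((SU (x + h) y + barrier (x + h) y) - (SU x y + barrier x y)) +
   ((SU (x - h) y + barrier (x - h) y) - (SU x y + barrier x y)) +
   ((SU x (y + h) + barrier x (y + h)) - (SU x y + barrier x y)) +
   ((SU x (y - h) + barrier x (y - h)) - (SU x y + barrier x y)) +
   k * ((SU x (y + h) + barrier x (y + h)) - (SU x y + barrier x y)).
  by rewrite /discrete_darboux -/k; ring.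
have dbar : discrete_darboux s barrier h x y = C * h * (2 * h ^+ 2 + 2 * k * h).
  by rewrite /discrete_darboux -/k /barrier; ring.
have : k * ((SU x (y + h) + barrier x (y + h)) - (SU x y + barrier x y)) <= 0.
  by rewrite pmulr_rle0 // subr_le0.
move: dsum; rewrite dsigned dbar => dsum kle0 bnd.
have bnd' : - signed t (discrete_darboux s U h x y) <= C * h ^+ 3 + C * h ^+ 3 * y^-1.
  have -> : - signed t (discrete_darboux s U h x y) = signed (~~ t) (discrete_darboux s U h x y).
    by rewrite /signed; case: (t) => //=; rewrite opprK.
  by apply: le_trans (signed_norm _ _) _; rewrite mulrDr mulr1 in bnd.
have kbnd : 2 * (C * h ^+ 3 * y^-1) <= C * h * (2 * k * h).
  have -> : 2 * (C * h ^+ 3 * y^-1) = C * h * (2 * (h / y) * h) by ring.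
  by rewrite ler_pM2l ?mulr_gt0 // ler_pM2r // ler_pM2l.
have p1 : 0 < C * h ^+ 3 by rewrite mulr_gt0 ?exprn_gt0.
have p2 : 0 < C * h ^+ 3 * y^-1 by rewrite mulr_gt0 ?invr_gt0.
have ek : C * h * (2 * h ^+ 2 + 2 * k * h) = 2 * (C * h ^+ 3) + C * h * (2 * k * h) by ring.
rewrite ek in dsum.
have {}le1 : SU (x + h) y + barrier (x + h) y <= SU x y + barrier x y := le1.
have {}le2 : SU (x - h) y + barrier (x - h) y <= SU x y + barrier x y := le2.
have {}le3 : SU x (y + h) + barrier x (y + h) <= SU x y + barrier x y := le3.
have {}le4 : SU x (y - h) + barrier x (y - h) <= SU x y + barrier x y := le4.
lra.
Qed.

(** Maximum principle: maximise [lifted] over the component of [u]. The maximum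
    exceeds delta, so it is not attained on the outer boundary, where [U] and
    the barrier are at most delta / 2; and a neighbour outside the component has
    the other sign or none, so its value is at most delta / 2. If the component
    avoids all squares, the maximum is thus a local one, which is impossible. *)
Let reaches_square (u : node) : (u.2 : nat) = 0%N -> delta < `|U (X u) 0| ->
  exists k, exists2 v, v \in square k & connect (nodal_step color) u v.
Proof.
move=> u0 bigU; apply: contrapT => noreach.
have noSq v k : connect (nodal_step color) u v -> ~~ square k v.
  by move=> uv; apply/negP => vk; apply: noreach; exists k, v.
pose t := 0 < U (X u) 0.
have Yu : Y u = 0 by rewrite /Y u0 mulr0.
have U0 : signed t (U (X u) (Y u)) = `|U (X u) 0|.
  rewrite Yu /signed /t; case: ltP => [/gtr0_norm//|/ler0_norm//].
have delta_ge0 : 0 <= delta.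
  have := le_trans (barrier_ge0 u) (barrier_le u); lra.
have colu : color u = Some t.
  apply/color_off_signed; first by move=> k; exact: noSq.
  by rewrite U0 (le_lt_trans delta_ge0).
case: (@Order.TotalTheory.arg_maxP _ _ _ u (fun v => connect (nodal_step color) u v) (lifted t) (connect0 _ _)).
move=> v uv vmax.
have nv k := noSq v k uv.
have colv : color v = Some t by rewrite -(connect_nodal_sg uv).
have big : delta < lifted t v.
  apply: lt_le_trans (vmax u (connect0 _ _)); rewrite /lifted U0.
  by have := barrier_ge0 u; lra.
have inside : ~~ ((B <= `|X v|) || (B <= Y v)).
  apply/negP => /(far_small (Y_ge0 v)) small.
  have := signed_norm t (U (X v) (Y v)); have := barrier_le v.
  by move: big; rewrite /lifted; lra.
move: inside; rewrite negb_or -!ltNge ltr_norml => /andP[/andP[XvN XvB] YvB].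
apply: (@no_local_max t v nv).
- by rewrite lt0n; apply/eqP => v0; move: XvN; rewrite /X v0 mulr0 addr0 ltxx.
- have : h * (v.1 : nat)%:R < h * (2 * M)%:R.
    by rewrite natrM mulrCA hM; move: XvB; rewrite /X; lra.
  by rewrite ltr_pM2l // ltr_nat mul2n.
- by move: YvB; rewrite /Y -hM ltr_pM2l // ltr_nat.
move=> v' vv'.
have [same|diff] := eqVneq (color v') (Some t).
  apply: vmax; apply: connect_trans uv _; apply: connect1.
  by rewrite /nodal_step same colv eqxx andbT.
apply: (@le_trans _ _ (delta / 2)); last by move: big; lra.
suff neg : signed t (U (X v') (Y v')) <= 0.
  by have := barrier_le v'; rewrite /lifted; lra.
case: (pickP (fun k => square k v')) => [k v'k|nv'].
  have ek : e k = ~~ t.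
    by move: diff; rewrite (color_square v'k); case: (e k); case: (t).
  have [dx dy] := adj_close vv'.
  have off : (X v', Y v') != (a k, b k).
    apply: contra (nv k) => /eqP[xa yb]; rewrite /square /on_square -xa -yb.
    by apply/andP; split; move: dx dy hr h_gt0; lra.
  have := near_sign v'k off; rewrite ek /signed; case: (t) => /=; lra.
rewrite leNgt; apply/negP => pos; move/negP: diff; apply; apply/eqP.
by apply/color_off_signed => // k; rewrite nv'.
Qed.

(** The rectangle [-B, B] x [0, B] carries a grid of step h. Each point of the
    axis where U is larger than delta in absolute value lies in a component that
    reaches a square of its own sign, and [nodal_changes] applies. *)
Theorem discrete_sign_changes (L : nat) (P : nat -> nat) :
  (forall i, (i <= L)%N -> (P i <= M.*2)%N) ->
  (forall i j, (i <= j)%N -> (j <= L)%N -> (P i <= P j)%N) ->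
  (forall i, (i <= L)%N -> delta < `|U (- B + h * (P i)%:R) 0|) ->
  (\sum_(i < L) ((0 < U (- B + h * (P i)%:R) 0)%R != (0 < U (- B + h * (P i.+1)%:R) 0)%R)
    <= 2 * #|I|.-1)%N.
Proof.
move=> PM Pmono Pbig.
pose V i : node := (inord (P i), ord0).
have VE i : (i <= L)%N -> X (V i) = - B + h * (P i)%:R.
  by move=> iL; rewrite /X /V /= inordK // ltnS PM.
have Vcol i : (i <= L)%N -> color (V i) = Some (0 < U (- B + h * (P i)%:R) 0).
  move=> iL; apply/color_off_signed.
    move=> k; rewrite /square /on_square negb_and; apply/orP; right.
    rewrite /Y /= mulr0 sub0r normrN -ltNge gtr0_norm ?b_gt_r //.
    exact: lt_trans r_gt0 (b_gt_r k).
  rewrite VE // /Y /= mulr0 /signed.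
  have d0 : 0 <= delta.
    have := le_trans (barrier_ge0 (V i)) (barrier_le (V i)); lra.
  have := le_lt_trans d0 (Pbig i iL); rewrite normr_gt0 => u0.
  by case: ifP => // /negbT; rewrite -leNgt oppr_gt0 lt_neqAle u0 => ->.
apply: leq_trans (nodal_changes (sg := color) (Sq := square) (P := V) (L := L) _ _ _ _).
- apply: leq_sum => i _; rewrite !Vcol ?(ltnW (ltn_ord i)) //.
- move=> k u v uk vk.
  apply: (@rectangle_nodal_connected _ _ _ color
    (fun i => `|- B + h * i%:R - a k| <= r) (fun j => `|h * j%:R - b k| <= r)).
  + move=> x y z xy yz; rewrite !ler_norml => /andP[? ?] /andP[? ?].
    have : h * x%:R <= h * y%:R by rewrite ler_pM2l // ler_nat.
    have : h * y%:R <= h * z%:R by rewrite ler_pM2l // ler_nat.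
    by move=> *; apply/andP; split; lra.
  + move=> x y z xy yz; rewrite !ler_norml => /andP[? ?] /andP[? ?].
    have : h * x%:R <= h * y%:R by rewrite ler_pM2l // ler_nat.
    have : h * y%:R <= h * z%:R by rewrite ler_pM2l // ler_nat.
    by move=> *; apply/andP; split; lra.
  + move=> u' v' u1 u2 v1 v2.
    by rewrite (@color_square k u') ?(@color_square k v') // /square /on_square ?u1 ?v1.
  + by case/andP: uk.
  + by case/andP: uk.
  + by case/andP: vk.
  + by case/andP: vk.
- by move=> i iL.
- move=> i j ij jL; rewrite /V /= !inordK ?ltnS ?PM //; first exact: Pmono.
  exact: leq_trans jL.
- move=> i iL; apply: reaches_square => //; rewrite VE //; exact: Pbig.
Qed.

End DiscreteNodalTheorem.

(** * Choosing and sampling a grid *)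

Lemma continuous_sumf (R : realType) (I : Type) (r : seq I) (F : I -> R -> R) :
  (forall i, continuous (F i)) -> continuous (fun x => \sum_(i <- r) F i x).
Proof.
move=> cF; elim: r => [|i r IH].
  rewrite (_ : (fun _ => _) = fun=> 0); first exact: continuous_constf.
  by apply/funext => x; rewrite big_nil.
rewrite (_ : (fun _ => _) = fun x => F i x + \sum_(j <- r) F j x).
  exact: continuous_addf.
by apply/funext => x; rewrite big_cons.
Qed.

Section GridSampling.
Context {R : realType}.

(** Finitely many local scales admit a common one. *)
Lemma uniform_pos (J : finType) (P : J -> R -> Prop) :
  (forall k r r', P k r -> 0 < r' <= r -> P k r') ->
  (forall k, exists2 r, 0 < r & P k r) -> exists2 r, 0 < r & forall k, P k r.
Proof.
move=> Pdown Pex.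
have /choice[f Pf] : forall k, exists r, 0 < r /\ P k r.
  by move=> k; have [r r0 Pr] := Pex k; exists r.
have r0 : 0 < \big[Order.min/1]_k f k by apply: lt_bigmin => // k _; case: (Pf k).
(* The value 1 serves as minimum of the empty family. *)
exists (\big[Order.min/1]_k f k) => // k; case: (Pf k) => _ /Pdown; apply.
by rewrite r0 bigmin_le.
Qed.

Lemma grid_step_exists (B eps : R) : 0 < B -> 0 < eps ->
  exists M h, [/\ 0 < h, h * M%:R = B & h <= eps].
Proof.
move=> B0 eps0; pose M := (Num.truncn (B / eps)).+1.
have M0 : 0 < M%:R :> R by rewrite ltr0n.
exists M, (B / M%:R); split; first by rewrite divr_gt0.
  by rewrite divfK // gt_eqF.
by rewrite ler_pdivrMr // -ler_pdivrMl // mulrC ltW // truncnS_gt.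
Qed.

Lemma grid_sampling (B h : R) (M L : nat) (p : nat -> R) : 0 < h -> h * M%:R = B ->
  (forall i j, (i <= j)%N -> (j <= L)%N -> p i <= p j) ->
  (forall i, (i <= L)%N -> `|p i| <= B) ->
  exists P : nat -> nat, [/\ forall i, (i <= L)%N -> (P i <= M.*2)%N,
    forall i j, (i <= j)%N -> (j <= L)%N -> (P i <= P j)%N &
    forall i, (i <= L)%N -> `|- B + h * (P i)%:R - p i| <= h].
Proof.
move=> hp hM pmono pB; pose P i := Num.truncn ((p i + B) / h).
have Pitv i : (i <= L)%N -> h * (P i)%:R <= p i + B < h * (P i).+1%:R.
  move=> iL; have := pB i iL; rewrite ler_norml => /andP[pb _].
  have : 0 <= (p i + B) / h by rewrite divr_ge0 ?(ltW hp) //; lra.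
  move=> /truncn_itv/andP[]; rewrite -/(P i) ler_pdivlMr // ltr_pdivrMr //.
  by rewrite ![_ * h]mulrC => -> ->.
exists P; split.
- move=> i iL; have /andP[Pi _] := Pitv i iL; have := pB i iL.
  rewrite ler_norml => /andP[_ pb]; rewrite -(ler_nat R) -(ler_pM2l hp) -mul2n natrM mulrCA hM.
  by lra.
- move=> i j ij jL; rewrite -ltnS -(ltr_nat R) -(ltr_pM2l hp).
  have /andP[Pi _] := Pitv i (leq_trans ij jL); have /andP[_ Pj] := Pitv j jL.
  by apply: le_lt_trans Pi _; apply: le_lt_trans Pj; rewrite lerD2r; exact: pmono.
- move=> i iL; have := Pitv i iL; rewrite -natr1 mulrDr mulr1 => /andP[? ?].
  by rewrite ler_norml; apply/andP; split; lra.
Qed.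

Lemma sign_close (u v delta : R) : `|u - v| < delta -> 2 * delta <= `|v| ->
  delta < `|u| /\ (0 < u) = (0 < v).
Proof.
move=> uv dv; split.
  have := ler_normB u (u - v); have -> : u - (u - v) = v by ring.
  lra.
move: uv dv; rewrite ltr_norml ler_normr => /andP[? ?] /orP[] dv.
  have v0 : 0 < v by lra.
  have u0 : 0 < u by lra.
  by rewrite v0 u0.
have v0 : v < 0 by lra.
have u0 : u < 0 by lra.
by rewrite !ltNge !ltW.
Qed.

Lemma far_triangle (u v w d : R) : 3 * d <= `|v - w| -> `|u - w| <= d -> 2 * d <= `|u - v|.
Proof.
move=> h1 h2; have := ler_normB (u - w) (u - v).
have -> : u - w - (u - v) = v - w by ring.
lra.
Qed.

End GridSampling.

(** * Sign changes for distinct charges *)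

Section DistinctCharges.
Context {R : realType}.
Variables (s : R) (I : finType) (a b c : I -> R).
Hypothesis s_ge : 1 / 2 <= s.
Hypothesis b_gt0 : forall k, 0 < b k.
Hypothesis c_neq0 : forall k, c k != 0.
Hypothesis centres_inj : forall j k, a j = a k -> b j = b k -> j = k.

Definition power_sum (x : R) : R := \sum_k c k * ((x - a k) ^+ 2 + b k ^+ 2) `^ (- s).

Let U (x y : R) : R := \sum_k c k * ring_potential s (a k) (b k) x y.
Let W : R := integral0pi (ring_weight s).

Let s_gt0 : 0 < s. Proof. by move: s_ge; lra. Qed.

(** Read off from the divergence at the charge: if the total weight were not
    positive, the potential would be nonpositive everywhere. *)
Lemma ring_weight_integral_gt0 : 0 < W.
Proof.
have [r r0 big] := @ring_potential_blowup R s s_ge 0 1 1 ltr01.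
have pos : 0 < (0 + r - 0) ^+ 2 + (1 - 1 : R) ^+ 2.
  by rewrite add0r subr0 subrr expr0n addr0 exprn_gt0.
have G1 : 1 <= ring_potential s 0 1 (0 + r) 1.
  apply: big => //; first by rewrite add0r subr0 gtr0_norm.
  by rewrite subrr normr0 ltW.
rewrite ltNge; apply/negP => W0.
suff : ring_potential s 0 1 (0 + r) 1 <= (r ^+ 2) `^ (- s) * W.
  have : (r ^+ 2) `^ (- s) * W <= 0 by rewrite mulr_ge0_le0 ?powR_ge0.
  by lra.
rewrite /W -integral0piZ; last exact: ring_weight_continuous.
apply: le_integral0pi.
- exact: ring_integrand_continuous.
- exact/continuous_scalef/ring_weight_continuous.
move=> t _; rewrite mulrC ler_wpM2r ?powR_ge0 //.
apply: ler_powR_npos; [by rewrite oppr_le0 ltW|exact: exprn_gt0|].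
apply: le_trans _ (ring_dist2_ge _ _ _ ler01 ler01).
by rewrite add0r subr0 lerDl sqr_ge0.
Qed.

Let U_axis x : U x 0 = W * power_sum x.
Proof.
rewrite /U /power_sum mulr_sumr; apply: eq_bigr => k _.
by rewrite (ring_potential_axis s_ge) mulrCA.
Qed.

Let power_sum_continuous : continuous power_sum.
Proof.
apply: continuous_sumf => k.
have cid : continuous (fun t : R => t - a k).
  by apply: continuous_subf; [move=> t; exact: cvg_id|exact: continuous_constf].
apply: (continuous_scalef (k := c k)); apply: continuous_powRf.
  by move=> t; rewrite ltr_pwDr ?exprn_gt0 ?sqr_ge0.
apply: continuous_addf; last exact: continuous_constf.
exact: (continuous_mulf cid cid).
Qed.

Let discrete_darboux_sum (G : I -> R -> R -> R) h x y :
  discrete_darboux s (fun x y => \sum_k c k * G k x y) h x y =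
  \sum_k c k * discrete_darboux s (G k) h x y.
Proof.
rewrite /discrete_darboux !mulr_sumr -!big_split /= -!sumrB mulr_sumr -big_split /=.
by apply: eq_bigr => k _; ring.
Qed.

Let norm_sum_le (F D : I -> R) (z : R) : (forall k, `|F k| <= D k * z) ->
  `|\sum_k c k * F k| <= (\sum_k `|c k| * D k) * z.
Proof.
move=> FD; apply: le_trans (ler_norm_sum _ _ _) _; rewrite mulr_suml.
by apply: ler_sum => k _; rewrite normrM -mulrA ler_wpM2l.
Qed.

(** A common scale for the charges: distance to the axis and mutual distance in
    the sup norm, which is the one adapted to square neighbourhoods. *)
Let separation : exists2 d, 0 < d & forall k, 3 * d <= b k /\
  forall j, j != k -> (3 * d <= `|a j - a k|) || (3 * d <= `|b j - b k|).
Proof.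
have [] := @uniform_pos R (I * I)%type (fun jk d => 3 * d <= b jk.2 /\
  (jk.1 != jk.2 -> (3 * d <= `|a jk.1 - a jk.2|) || (3 * d <= `|b jk.1 - b jk.2|))).
- move=> [j k] r r' /= [rb rd] /andP[r'0 r'r]; split; first by lra.
  move=> /rd /orP[] ?; apply/orP; [left|right]; lra.
- move=> [j k] /=; have [->|jk] := eqVneq j k.
    by exists (b k / 3); [rewrite divr_gt0|split=> //; rewrite mulrC divfK].
  have [aE|aN] := eqVneq (a j) (a k).
    have bN : 0 < `|b j - b k|.
      rewrite normr_gt0 subr_eq0; apply: contra jk => /eqP bE.
      by apply/eqP; exact: centres_inj.
    exists (Order.min (b k) `|b j - b k| / 3); first by rewrite divr_gt0 // lt_min b_gt0 bN.
    rewrite mulrC divfK //; split; first by rewrite ge_min lexx.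
    by move=> _; rewrite orbC ge_min lexx !orbT.
  have aN' : 0 < `|a j - a k| by rewrite normr_gt0 subr_eq0.
  exists (Order.min (b k) `|a j - a k| / 3); first by rewrite divr_gt0 // lt_min b_gt0 aN'.
  rewrite mulrC divfK //; split; first by rewrite ge_min lexx.
  by move=> _; rewrite ge_min lexx !orbT.
move=> d d0 dP; exists d => // k; split; first by case: (dP (k, k)).
by move=> j jk; case: (dP (j, k)) => _; exact.
Qed.

Let signed (t : bool) (u : R) : R := if t then u else - u.

(** Within distance r of one charge the others are at distance at least d, so
    their contribution is bounded while that of the near charge is as large as
    desired. *)
Let near_charges d : 0 < d -> (forall k, 3 * d <= b k /\
    forall j, j != k -> (3 * d <= `|a j - a k|) || (3 * d <= `|b j - b k|)) ->
  exists2 r, 0 < r <= d & forall k x y, (`|x - a k| <= r) && (`|y - b k| <= r) ->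
    (x, y) != (a k, b k) -> 0 < signed (0 < c k) (U x y).
Proof.
(* Bound for a unit charge at distance at least d. *)
move=> d0 dP; pose beta := (d ^+ 2) `^ (- s) * pi.
have beta0 : 0 <= beta by rewrite mulr_ge0 ?powR_ge0 ?pi_ge0.
pose B0 := \sum_k `|c k| * beta.
have [] := @uniform_pos R I (fun k r => forall x y, `|x - a k| <= r -> `|y - b k| <= r ->
    0 < (x - a k) ^+ 2 + (y - b k) ^+ 2 ->
    (B0 + 1) / `|c k| <= ring_potential s (a k) (b k) x y).
- move=> k r r' Pr /andP[_ r'r] x y xr yr; apply: Pr.
    exact: le_trans xr r'r.
  exact: le_trans yr r'r.
- by move=> k; apply: ring_potential_blowup.
move=> r r0 rP; exists (Order.min r d); first by rewrite lt_min r0 d0 ge_min lexx orbT.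
move=> k x y /andP[]; rewrite !le_min => /andP[xr xd] /andP[yr yd] off.
have [dk dj] := dP k.
have y0 : 0 <= y by move: yd; rewrite ler_norml => /andP[? _]; lra.
have pos : 0 < (x - a k) ^+ 2 + (y - b k) ^+ 2.
  rewrite lt_neqAle addr_ge0 ?sqr_ge0 // andbT eq_sym paddr_eq0 ?sqr_ge0 //.
  rewrite !sqrf_eq0 !subr_eq0; apply: contra off => /andP[/eqP -> /eqP ->]; exact: eqxx.
have Gk := rP k x y xr yr pos.
have ck : 0 < `|c k| by rewrite normr_gt0.
have {}Gk : B0 + 1 <= `|c k| * ring_potential s (a k) (b k) x y.
  by rewrite mulrC -ler_pdivrMr.
have rest : `|\sum_(j | j != k) c j * ring_potential s (a j) (b j) x y| <= B0.
  apply: le_trans (ler_norm_sum _ _ _) _; rewrite /B0 [leRHS](bigD1 k) //=.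
  rewrite -[leLHS]add0r; apply: lerD; first by rewrite mulr_ge0.
  apply: ler_sum => j jk; rewrite normrM ler_wpM2l //.
  have far : (d <= `|x - a j|) || (d <= `|y - b j|).
    have d2 : d <= 2 * d by rewrite ler_peMl ?ler1n // ltW.
    by case/orP: (dj j jk) => /far_triangle h; apply/orP; [left|right];
      apply: le_trans d2 _; exact: h.
  have := ring_potential_bounds s_ge y0 (ltW (b_gt0 j)) d0 (off_square_dist d0 far).
  by case/andP=> g0 gb; rewrite ger0_norm.
have := rest; rewrite ler_norml => /andP[rest1 rest2].
rewrite /U (bigD1 k) //= /signed.
case: ifP => [ck0|/negbT]; first by rewrite gtr0_norm // in Gk; lra.
rewrite -leNgt => ck0; rewrite ler0_norm // mulNr in Gk; lra.
Qed.

(** D is chosen so that (D^2)^(-s) equals the prescribed small number. *)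
Let far_bound delta : 0 < delta -> exists2 D, 0 < D & forall x y, 0 <= y ->
  (forall k, (D <= `|x - a k|) || (D <= `|y - b k|)) -> `|U x y| <= delta / 2.
Proof.
move=> delta0; pose S := \sum_k `|c k|.
have S0 : 0 <= S by apply: sumr_ge0.
have p0 := @pi_gt0 R.
pose eps := delta / (2 * pi * (S + 1)).
have eps0 : 0 < eps by rewrite divr_gt0 // !mulr_gt0 //; lra.
(* The solution of (D^2)^(-s) = eps. *)
pose D := eps `^ (- (2 * s)^-1); have D0 : 0 < D by exact: powR_gt0.
have DE : (D ^+ 2) `^ (- s) = eps.
  rewrite -powR_mulrn ?(ltW D0) // -!powRrM.
  have -> : - (2 * s)^-1 * (2%:R * - s) = 1 by field; rewrite gt_eqF.
  by rewrite powRr1 // ltW.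
exists D => // x y y0 far.
apply: (@le_trans _ _ (S * (eps * pi))); last first.
  apply: (@le_trans _ _ ((S + 1) * (eps * pi))).
    by rewrite ler_wpM2r ?lerDl // mulr_ge0 // ltW.
  rewrite /eps le_eqVlt; apply/orP; left; apply/eqP.
  have Sn : S + 1 != 0 by rewrite gt_eqF //; lra.
  suff gen (q : R) : q != 0 -> (S + 1) * (delta / (2 * q * (S + 1)) * q) = delta / 2.
    by apply: gen; rewrite gt_eqF.
  by move=> qn; field; rewrite Sn qn.
rewrite /S mulr_suml /U; apply: le_trans (ler_norm_sum _ _ _) _.
apply: ler_sum => k _; rewrite normrM ler_wpM2l //.
have := ring_potential_bounds s_ge y0 (ltW (b_gt0 k)) D0 (off_square_dist D0 (far k)).
by rewrite DE => /andP[g0 gb]; rewrite ger0_norm.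
Qed.

Let box delta (L : nat) (p : nat -> R) : 0 < delta -> exists B, [/\ 0 < B,
  forall i, (i <= L)%N -> `|p i| <= B &
  forall x y, 0 <= y -> (B <= `|x|) || (B <= y) -> `|U x y| <= delta / 2].
Proof.
move=> delta0; have [D D0 farD] := far_bound delta0.
have [A A0 AP] : exists2 A, 0 <= A & forall k, `|a k| + b k <= A.
  exists (\sum_k (`|a k| + b k)).
    by rewrite sumr_ge0 // => j _; rewrite addr_ge0 // ltW.
  by move=> k; rewrite (bigD1 k) //= lerDl sumr_ge0 // => j _; rewrite addr_ge0 // ltW.
have [Q Q0 QP] : exists2 Q, 0 <= Q & forall i, (i <= L)%N -> `|p i| <= Q.
  exists (\sum_(i < L.+1) `|p i|); first by rewrite sumr_ge0.
  by move=> i iL; rewrite (bigD1 (Ordinal (iL : (i < L.+1)%N))) //= lerDl sumr_ge0.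
exists (D + A + Q); split.
- by rewrite -addrA ltr_pwDl // addr_ge0.
- by move=> i /QP /le_trans; apply; rewrite lerDr addr_ge0 // ltW.
move=> x y y0 far; apply: farD => // k; have Ak := AP k.
have [ak bk] : `|a k| <= A /\ b k <= A.
  by split; apply: le_trans Ak; rewrite ?lerDl ?lerDr // ltW.
case/orP: far => far; apply/orP; [left|right].
  have := ler_normD (x - a k) (a k); rewrite subrK => tri.
  by rewrite -(lerD2r `|a k|); apply: le_trans tri; apply: le_trans far; rewrite -addrA lerD2l -[leLHS]addr0 lerD.
apply: le_trans (ler_norm _); rewrite lerBrDr; apply: le_trans far.
by rewrite -addrA lerD2l -[leLHS]addr0 lerD.
Qed.

Let uniform_consistency r B : 0 < r -> (forall k, r <= b k) -> 0 <= B -> exists2 C, 0 < C &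
  forall h, 0 < h -> 2 * h <= r ->
  (forall x, `|x| <= B -> `|U x h - U x 0| <= C * h ^+ 2) /\
  (forall x y, `|x| <= B -> h <= y <= B ->
    (forall k, ~~ ((`|x - a k| <= r) && (`|y - b k| <= r))) ->
    `|discrete_darboux s U h x y| <= C * h ^+ 3 * (1 + y^-1)).
Proof.
move=> r0 rb B0.
have /choice[C1 C1P] : forall k, exists C, 0 <= C /\ forall h x y, 0 < h -> 2 * h <= r ->
    `|x| <= B -> h <= y <= B -> (r <= `|x - a k|) || (r <= `|y - b k|) ->
    `|discrete_darboux s (ring_potential s (a k) (b k)) h x y| <= C * h ^+ 3 * (1 + y^-1).
  by move=> k; have [C] := ring_potential_consistency s_ge (a k) (ltW (b_gt0 k)) r0 B0; exists C.
have /choice[C2 C2P] : forall k, exists C, 0 <= C /\ forall h x, 0 < h -> 2 * h <= r ->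
    `|x| <= B -> `|ring_potential s (a k) (b k) x h - ring_potential s (a k) (b k) x 0| <= C * h ^+ 2.
  by move=> k; have [C] := ring_potential_axis_step s_ge (a k) r0 (rb k) B0; exists C.
have S10 : 0 <= \sum_k `|c k| * C1 k.
  by apply: sumr_ge0 => k _; rewrite mulr_ge0 //; case: (C1P k).
have S20 : 0 <= \sum_k `|c k| * C2 k.
  by apply: sumr_ge0 => k _; rewrite mulr_ge0 //; case: (C2P k).
exists (\sum_k `|c k| * C1 k + \sum_k `|c k| * C2 k + 1).
  by rewrite ltr_wpDl // addr_ge0.
move=> h h0 hr; split.
- move=> x xB; rewrite /U -sumrB.
  rewrite (eq_bigr (fun k => c k * (ring_potential s (a k) (b k) x h -
    ring_potential s (a k) (b k) x 0))); last by move=> k _; rewrite mulrBr.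
  apply: le_trans (norm_sum_le (D := C2) (z := h ^+ 2) _) _.
    by move=> k; apply: (C2P k).2.
  by rewrite ler_wpM2r ?sqr_ge0 // addrAC lerDr addr_ge0.
- move=> x y xB yB off; rewrite /U discrete_darboux_sum.
  have y0 : 0 < y by case/andP: yB => + _; apply: lt_le_trans.
  apply: le_trans (norm_sum_le (D := C1) (z := h ^+ 3 * (1 + y^-1)) _) _.
    move=> k; rewrite mulrA; apply: (C1P k).2 => //.
    by have := off k; rewrite negb_and -!ltNge => /orP[/ltW -> //|/ltW ->]; rewrite orbT.
  rewrite -mulrA ler_wpM2r //; last by rewrite -addrA lerDl addr_ge0.
  by rewrite mulr_ge0 ?addr_ge0 ?invr_ge0 ?exprn_ge0 // ltW.
Qed.

(** The scales are fixed in the order d, r (charges), delta, eta (points), B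
    (box), C (discretisation), h (grid); each depends on the preceding ones only. *)
Theorem distinct_charges_sign_changes (L : nat) (p : nat -> R) :
  (forall i j, (i <= j)%N -> (j <= L)%N -> p i <= p j) ->
  (forall i, (i <= L)%N -> power_sum (p i) != 0) ->
  (\sum_(i < L) ((0 < power_sum (p i))%R != (0 < power_sum (p i.+1))%R) <= 2 * #|I|.-1)%N.
Proof.
move=> pmono pne0.
have W0 := ring_weight_integral_gt0.
have signU x : (0 < power_sum x) = (0 < U x 0) by rewrite U_axis pmulr_rgt0.
have [d d0 dP] := separation.
have [r /andP[r0 rd] near_r] := near_charges d0 dP.
have [delta delta0 deltaP] : exists2 delta, 0 < delta &
    forall i : 'I_L.+1, 2 * delta <= `|U (p i) 0|.
  apply: uniform_pos => [i u v Pu /andP[v0 vu]|i].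
    by apply: le_trans Pu; rewrite ler_pM2l.
  exists (`|U (p i) 0| / 2); last by rewrite mulrC divfK.
  rewrite divr_gt0 // normr_gt0 U_axis mulf_neq0 ?(gt_eqF W0) //.
  by apply: pne0; rewrite -ltnS.
have [eta eta0 etaP] : exists2 eta, 0 < eta & forall (i : 'I_L.+1) x,
    `|x - p i| <= eta -> `|U x 0 - U (p i) 0| < delta.
  apply: uniform_pos => [i u v Pu /andP[v0 vu] x xv|i]; first by apply: Pu; exact: le_trans vu.
  have dW : 0 < delta / W by rewrite divr_gt0.
  have /cvgrPdist_lt /(_ _ dW) /nbhs_ballP[u /= u0 uP] := @power_sum_continuous (p i).
  exists (u / 2); first by rewrite divr_gt0.
  move=> x xu; rewrite !U_axis -mulrBr normrM (gtr0_norm W0) mulrC -ltr_pdivlMr //.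
  rewrite distrC; apply: uP; rewrite /ball /= distrC; apply: le_lt_trans xu _.
  by rewrite ltr_pdivrMr // ltr_pMr // ltr1n.
have [B [B0 pB farB]] := box L p delta0.
have rb k : r < b k.
  have [dk _] := dP k; apply: le_lt_trans rd _; apply: lt_le_trans dk.
  by rewrite ltr_pMl // ltr1n.
have [C C0 CP] := uniform_consistency r0 (fun k => ltW (rb k)) (ltW B0).
have Q0 : 0 < B ^+ 2 + 2 * B by rewrite addr_gt0 ?exprn_gt0 ?mulr_gt0.
have [|M [h [h0 hM hsmall]]] := grid_step_exists (eps := Order.min (r / 2)
    (Order.min eta (delta / 2 / (C * (B ^+ 2 + 2 * B))))) B0.
  by rewrite !lt_min eta0 !divr_gt0 // mulr_gt0.
move: hsmall; rewrite !le_min => /andP[hr /andP[heta hdelta]].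
have h2r : 2 * h <= r by rewrite mulrC -ler_pdivlMr.
have barrier : C * h * (B ^+ 2 + 2 * B) <= delta / 2.
  by rewrite mulrAC mulrC -ler_pdivlMr // mulr_gt0.
have [P [PM Pmono Pclose]] := grid_sampling h0 hM pmono pB.
have sample i : (i <= L)%N -> delta < `|U (- B + h * (P i)%:R) 0| /\
    (0 < U (- B + h * (P i)%:R) 0) = (0 < power_sum (p i)).
  move=> iL; rewrite signU; apply: sign_close.
    by apply: (etaP (Ordinal (iL : (i < L.+1)%N))); exact: (le_trans (Pclose i iL) heta).
  exact: (deltaP (Ordinal (iL : (i < L.+1)%N))).
rewrite (eq_bigr (fun i : 'I_L => nat_of_bool ((0 < U (- B + h * (P i)%:R) 0) !=
    (0 < U (- B + h * (P i.+1)%:R) 0)))); last first.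
  move=> i _; congr (nat_of_bool (_ != _)); symmetry.
    exact: (sample i (ltnW (ltn_ord i))).2.
  exact: (sample i.+1 (ltn_ord i)).2.
have [axis cons] := CP h h0 h2r.
have disjoint j k x y : (`|x - a j| <= r) && (`|y - b j| <= r) ->
    (`|x - a k| <= r) && (`|y - b k| <= r) -> j = k.
  move=> /andP[xj yj] /andP[xk yk]; apply/eqP; apply: contraT => jk.
  have [_ /(_ j jk)] := dP k.
  have tri (u v w : R) : `|u - v| <= r -> `|u - w| <= r -> 3 * d <= `|v - w| -> False.
    move=> uv uw /far_triangle/(_ (le_trans uw rd)); rewrite leNgt => /negP; apply.
    by apply: le_lt_trans uv _; apply: le_lt_trans rd _; rewrite ltr_pMl // ltr1n.
  by case/orP => [/(tri _ _ _ xj xk)|/(tri _ _ _ yj yk)].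
apply: (@discrete_sign_changes R s I a b (fun k => 0 < c k) U M B h r delta C) => //.
- by move=> i /sample[].
Qed.

End DistinctCharges.

(** * A power sum that vanishes on an interval vanishes everywhere *)

Section UniqueContinuation.
Context {R : realType}.
Variable Q : {poly R}.
Hypothesis Q_gt0 : forall x, 0 < Q.[x].

(** Positive functions with logarithmic derivative [lr_num / Q]. Products of
    real powers of the factors of Q are of this kind; the class is closed under
    the operations that [is_derive_quotient] needs. *)
Record log_rational := LogRational {
  lr_fun :> R -> R;
  lr_num : {poly R};
  lr_gt0 : forall x, 0 < lr_fun x;
  lr_derive : forall x : R, is_derive x 1 lr_fun (lr_fun x * (lr_num.[x] / Q.[x])) }.

Let one_derive (x : R) : is_derive x 1 (fun=> 1 : R) (1 * ((0 : {poly R}).[x] / Q.[x])).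
Proof. by rewrite horner0 mul0r mulr0; exact: is_derive_constf. Qed.

Definition lr_one : log_rational := LogRational (fun=> ltr01) one_derive.

Let div_gt0 (w v : log_rational) x : 0 < w x / (v x * Q.[x]).
Proof. by rewrite divr_gt0 ?mulr_gt0 ?lr_gt0. Qed.

Let div_derive (w v : log_rational) (x : R) :
  is_derive x 1 (fun x => w x / (v x * Q.[x]))
    (w x / (v x * Q.[x]) * ((lr_num w - lr_num v - Q^`()).[x] / Q.[x])).
Proof.
have dvQ := is_derive_mulf (lr_derive v x) (is_derive_poly Q x).
have vQ0 t : 0 < v t * Q.[t] by rewrite mulr_gt0 ?lr_gt0.
have d := is_derive_mulf (lr_derive w x) (is_derive_invf vQ0 dvQ).
apply: (is_derive_eq d); rewrite !hornerD !hornerN.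
have v0 := lr_gt0 v x; have q0 := Q_gt0 x.
by field; rewrite !gt_eqF.
Qed.

(** The extra factor Q in the denominator absorbs the denominator created by
    one differentiation, so that coefficients remain polynomials. *)
Definition lr_div (w v : log_rational) := LogRational (div_gt0 w v) (div_derive w v).

Definition combination (l : seq ({poly R} * log_rational)) (x : R) : R :=
  \sum_(t <- l) t.1.[x] * t.2 x.

Let derived (w : log_rational) (t : {poly R} * log_rational) :=
  (t.1^`() * Q + t.1 * (lr_num t.2 - lr_num w), lr_div t.2 w).

(** Dividing by [w] turns the first term into the polynomial P; differentiation
    then lowers its degree and keeps the number of terms. *)
Let is_derive_quotient (P : {poly R}) (w : log_rational) l (x : R) :
  is_derive x 1 (fun x => combination ((P, w) :: l) x / w x)
    (combination ((P^`(), lr_one) :: [seq derived w t | t <- l]) x).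
Proof.
have w0 := lr_gt0 w.
rewrite (_ : (fun x => _) = fun x => P.[x] + \sum_(t <- l) t.1.[x] * (t.2 x / w x)); last first.
  apply/funext => z; rewrite /combination big_cons /= mulrDl mulfK ?gt_eqF //.
  by rewrite mulr_suml; congr (_ + _); apply: eq_bigr => t _; rewrite mulrA.
rewrite /combination big_cons /= mulr1 big_map /=.
apply: (is_derive_addf (is_derive_poly P x)).
apply: (@is_derive_sumf _ _ l (fun t x => t.1.[x] * (t.2 x / w x))
  (fun t x => (t.1^`() * Q + t.1 * (lr_num t.2 - lr_num w)).[x] * (t.2 x / (w x * Q.[x])))).
move=> t.
have d := is_derive_mulf (is_derive_poly t.1 x)
  (is_derive_mulf (lr_derive t.2 x) (is_derive_invf w0 (lr_derive w x))).
apply: (is_derive_eq d).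
rewrite hornerD !hornerM hornerD hornerN.
have wx0 := w0 x; have q0 := Q_gt0 x.
by field; rewrite !gt_eqF.
Qed.

(** Induction on the number of terms, then on the degree of the first
    coefficient. If a combination vanishes on an interval, so does the derivative
    of its quotient by the first function, which is a smaller combination and
    hence vanishes everywhere; the quotient is then constant, with value 0. *)
Theorem combination_unique_continuation (u v : R) l : u < v ->
  (forall x, u < x < v -> combination l x = 0) -> forall x, combination l x = 0.
Proof.
move=> uv; have [n] := ubnP (size l); elim: n l => // n IHn [|[P w] l] sl lz x.
  by rewrite /combination big_nil.
have [m] := ubnP (size P); elim: m P w l sl lz x => // m IHm P w l sl lz x sP.
have [P0|P0] := eqVneq P 0.
  have lE z : combination ((P, w) :: l) z = combination l z.
    by rewrite /combination big_cons P0 /= horner0 mul0r add0r.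
  by rewrite lE; apply: IHn => // z zuv; rewrite -lE lz.
pose F z := combination ((P, w) :: l) z / w z.
pose l1 := (P^`(), lr_one) :: [seq derived w t | t <- l].
have dF (z : R) : is_derive z 1 F (combination l1 z) by exact: is_derive_quotient.
have F0 z : u < z < v -> F z = 0 by move=> zuv; rewrite /F lz // mul0r.
have l1z (z : R) : combination l1 z = 0.
  apply: IHm => {z}.
  - by rewrite /= size_map.
  - move=> z zuv; have dz := dF z; have d0 : is_derive z 1 F 0.
      apply: (near_eq_is_derive (f := fun=> 0)) => //.
      have : \forall t \near z, t \in `]u, v[ by apply: near_in_itvoo; rewrite in_itv.
      by apply: filterS => t; rewrite in_itv /= => /F0.
    by case: dz => _ <-; case: d0.
  - by apply: leq_trans (lt_size_deriv P0) _; rewrite -ltnS.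
have dF0 (z : R) : is_derive z 1 F 0 by rewrite -(l1z z).
have mid : u < (u + v) / 2 < v by apply/andP; split; lra.
have Fx : F x = 0 by rewrite (@is_derive_0_is_cst R F x ((u + v) / 2) dF0) F0.
by move/eqP: Fx; rewrite /F mulf_eq0 invr_eq0 (gt_eqF (lr_gt0 w x)) orbF => /eqP.
Qed.

End UniqueContinuation.

Section PowerSumContinuation.
Context {R : realType}.
Variables (n : nat) (a b c : 'I_n -> R) (alpha : R).
Hypothesis b_neq0 : forall k, b k != 0.

Let q k : {poly R} := ('X - (a k)%:P) ^+ 2 + (b k ^+ 2)%:P.
Let Q : {poly R} := \prod_k q k.

Let qE k x : (q k).[x] = (x - a k) ^+ 2 + b k ^+ 2.
Proof. by rewrite /q hornerD horner_exp hornerXsubC hornerC. Qed.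

Let q_gt0 k x : 0 < (q k).[x].
Proof. by rewrite qE ltr_pwDr ?sqr_ge0 // lt_neqAle sqr_ge0 andbT eq_sym sqrf_eq0. Qed.

Let Q_gt0 x : 0 < Q.[x].
Proof. by rewrite /Q horner_prod prodr_gt0. Qed.

Let power k x := (q k).[x] `^ alpha.

Let power_gt0 k x : 0 < power k x. Proof. by rewrite powR_gt0. Qed.

Let power_derive (k : 'I_n) (x : R) : is_derive x 1 (power k) (power k x *
  ((alpha *: ((q k)^`() * \prod_(j | j != k) q j)).[x] / Q.[x])).
Proof.
have d := is_derive_powRf alpha (q_gt0 k x) (is_derive_poly (q k) x).
have QE : Q = q k * \prod_(j | j != k) q j by rewrite /Q (bigD1 k).
apply: (is_derive_eq d); rewrite hornerZ QE !hornerM /power.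
have -> : (q k).[x] `^ alpha = (q k).[x] `^ (alpha - 1) * (q k).[x].
  by rewrite -[X in _ * X]powRr1 ?(ltW (q_gt0 k x)) // -powRD ?subrK // (gt_eqF (q_gt0 k x)) implybT.
have qk0 := q_gt0 k x.
have p0 : 0 < (\prod_(j | j != k) q j).[x] by rewrite horner_prod prodr_gt0.
by field; rewrite !gt_eqF.
Qed.

Lemma power_sum_unique_continuation (u v : R) : u < v ->
  (forall x, u < x < v -> quadratic_power_sum a b c alpha x = 0) ->
  forall x, quadratic_power_sum a b c alpha x = 0.
Proof.
pose l := [seq ((c k)%:P, LogRational (power_gt0 k) (power_derive k)) | k <- enum 'I_n].
have lE x : quadratic_power_sum a b c alpha x = combination l x.
  rewrite /combination /l big_map big_enum /=; apply: eq_bigr => k _.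
  by rewrite hornerC /power qE.
move=> uv uvz x; rewrite lE; apply: (combination_unique_continuation Q_gt0 uv).
by move=> z /uvz; rewrite lE.
Qed.

End PowerSumContinuation.

(** * Merging equal charges *)

Section MergingCharges.
Context {R : realType}.
Variables (n : nat) (a b c : 'I_n -> R) (alpha : R).
Hypothesis b_neq0 : forall k, b k != 0.

Let pt k : R * R := (a k, `|b k|).
(** A representative of the charges located at the same point; it depends on the
    point only. *)
Let rep k : 'I_n := odflt k [pick j | pt j == pt k].

Let pt_rep k : pt (rep k) = pt k.
Proof. by rewrite /rep; case: pickP => [j /eqP//|/(_ k)]; rewrite eqxx. Qed.

Let rep_eq j k : pt j = pt k -> rep j = rep k.
Proof.
move=> jk; rewrite /rep jk; case: pickP => //= /(_ k).
by rewrite eqxx.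
Qed.

Let charge j := \sum_(k | rep k == j) c k.
Let reps : {pred 'I_n} := [pred j | (rep j == j) && (charge j != 0)].

Lemma merge_charges : exists m (a' b' c' : 'I_m -> R), [/\ (m <= n)%N,
  forall k, 0 < b' k, forall k, c' k != 0,
  forall j k, a' j = a' k -> b' j = b' k -> j = k &
  forall x, quadratic_power_sum a b c alpha x = power_sum (- alpha) a' b' c' x].
Proof.
exists #|reps|, (fun i => a (enum_val i)), (fun i => `|b (enum_val i)|),
  (fun i => charge (enum_val i)); split.
- by rewrite -[leqRHS]card_ord max_card.
- by move=> k; rewrite normr_gt0.
- by move=> k; have /andP[] : reps (enum_val k) := enum_valP k.
- move=> j k aE bE; apply: enum_val_inj.
  have /andP[/eqP rk _] : reps (enum_val k) := enum_valP k.
  have /andP[/eqP rj _] : reps (enum_val j) := enum_valP j.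
  by rewrite -rk -rj; apply: rep_eq; rewrite /pt aE bE.
move=> x; rewrite /power_sum opprK.
rewrite -(big_enum_val (fun j => charge j * ((x - a j) ^+ 2 + `|b j| ^+ 2) `^ alpha)) /=.
rewrite /quadratic_power_sum (partition_big rep (fun j => rep j == j)) /=; last first.
  by move=> k _; apply/eqP/rep_eq/pt_rep.
rewrite [RHS](eq_bigl (fun j => (rep j == j) && (charge j != 0))) //.
rewrite [RHS]big_mkcondr; apply: eq_bigr => j _.
transitivity (charge j * ((x - a j) ^+ 2 + `|b j| ^+ 2) `^ alpha).
  rewrite /charge mulr_suml; apply: eq_bigr => k /eqP rk.
  have := pt_rep k; rewrite rk => -[-> ->].
  by rewrite real_normK ?num_real.
by case: eqVneq => [->|//]; rewrite mul0r.
Qed.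

End MergingCharges.

(** * From sign changes to zeros *)

(** Covers infinite sets as well as finite ones that are too large. *)
Lemma uniq_points_of_card (R : realType) (A : set R) (K : nat) :
  ~ (A #<= `I_K)%card ->
  exists l : seq R, [/\ uniq l, size l = K.+1 & forall x, x \in l -> A x].
Proof.
move=> AK; have KA : (`I_K.+1 #<= A)%card.
  have [/finite_setP[m Am]|infA] := pselect (finite_set A); last first.
    by apply: card_le_trans (iffLR (infiniteP A) infA); exact: card_leT.
  rewrite (card_le_eqr Am) card_le_II ltnNge; apply/negP => mK; apply: AK.
  by rewrite (card_le_eql Am) card_le_II.
have /pcard_leP/unsquash f := KA.
exists [seq f i | i <- iota 0 K.+1]; split; last 2 first.
- by rewrite size_map size_iota.
- by move=> x /mapP[i]; rewrite mem_iota add0n => /andP[_ iK] ->; exact: (@funS _ _ _ _ f).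
rewrite map_inj_in_uniq ?iota_uniq // => i j.
rewrite !mem_iota !add0n => /andP[_ iK] /andP[_ jK]; apply: (@inj _ _ _ f); exact/mem_set.
Qed.

Lemma sum_double (N : nat) (F : nat -> nat) :
  (\sum_(j < N.*2) F j = \sum_(i < N) (F i.*2 + F i.*2.+1))%N.
Proof.
elim: N => [|N IH]; first by rewrite !big_ord0.
by rewrite doubleS !big_ord_recr /= IH addnA.
Qed.

Section CountingZeros.
Context {R : realType}.
Variables (s : R) (m : nat) (a b c : 'I_m -> R).
Hypothesis s_ge : 1 / 2 <= s.
Hypothesis b_gt0 : forall k, 0 < b k.
Hypothesis c_neq0 : forall k, c k != 0.
Hypothesis centres_inj : forall j k, a j = a k -> b j = b k -> j = k.

Let f := power_sum s a b c.

(** With coefficient [c k0] changed by +eps or -eps, the function takes at the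
    points p_0, z_0, p_1, z_1, .., p_N the signs of f at the p_i and a fixed sign,
    + or -, at the z_i. Next to each z_i the two sequences together have exactly
    two changes, hence 2 N <= 2 (2 (m - 1)). *)
Lemma interlaced_zeros_bound (N : nat) (z p : nat -> R) :
  (0 < m)%N ->
  (forall i, (i < N)%N -> p i < z i /\ z i < p i.+1) ->
  (forall i, (i < N)%N -> f (z i) = 0) ->
  (forall i, (i <= N)%N -> f (p i) != 0) ->
  (N <= 2 * m.-1)%N.
Proof.
move=> m0 pz fz fp; pose k0 := Ordinal m0.
pose g x := ((x - a k0) ^+ 2 + b k0 ^+ 2) `^ (- s).
have g0 x : 0 < g x by rewrite powR_gt0 // ltr_pwDr ?exprn_gt0 ?sqr_ge0.
have [eps eps0 epsP] : exists2 eps, 0 < eps & forall i : 'I_N.+1,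
    eps < `|c k0| /\ eps * g (p i) < `|f (p i)|.
  apply: uniform_pos => [i u v [uc ug] /andP[v0 vu]|i].
    split; first exact: le_lt_trans uc.
    by apply: le_lt_trans ug; rewrite ler_pM2r.
  have fi : 0 < `|f (p i)| by rewrite normr_gt0 fp // -ltnS.
  exists (Order.min (`|c k0| / 2) (`|f (p i)| / (2 * g (p i)))).
    by rewrite lt_min !divr_gt0 ?mulr_gt0 // normr_gt0.
  split.
    by rewrite gt_min ltr_pdivrMr // ltr_pMr ?normr_gt0 // ltr1n.
  rewrite -ltr_pdivlMr // gt_min; apply/orP; right.
  by rewrite ltr_pM2l // ltf_pV2 ?posrE ?mulr_gt0 // ltr_pMl // ltr1n.
(* The merged sequence p_0, z_0, p_1, z_1, .., p_N. *)
pose y j := if odd j then z j./2 else p j./2.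
have yE i : y i.*2 = p i by rewrite /y odd_double doubleK.
have yO i : y i.*2.+1 = z i by rewrite /y /= odd_double /= uphalf_double.
pose cs (t : bool) k := if k == k0 then c k + (-1) ^+ t * eps else c k.
have csE t x : power_sum s a b (cs t) x = f x + (-1) ^+ t * eps * g x.
  rewrite /f /power_sum (bigD1 k0) //= [in RHS](bigD1 k0) //= /cs eqxx mulrDl addrAC.
  by congr (_ + _ + _); apply: eq_bigr => k nk; rewrite (negbTE nk).
have cs0 t k : cs t k != 0.
  rewrite /cs; case: (k =P k0) => [->|_]; last exact: c_neq0.
  have [lt _] := epsP ord0; rewrite addr_eq0; apply/eqP => ce; move: lt.
  by rewrite ce normrN normrM normrX normrN1 expr1n mul1r gtr0_norm // ltxx.
have sgn_p t i : (i <= N)%N -> (0 < power_sum s a b (cs t) (p i)) = (0 < f (p i)) /\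
    power_sum s a b (cs t) (p i) != 0.
  move=> iN; have [_] := epsP (Ordinal (iN : (i < N.+1)%N)) => /= small.
  rewrite csE; set u := f (p i) in small *.
  have small' : `|(-1) ^+ t * eps * g (p i)| < `|u|.
    by rewrite -mulrA normrM normrX normrN1 expr1n mul1r gtr0_norm ?mulr_gt0.
  move: small'; set v := (-1) ^+ t * eps * g (p i); rewrite ltr_norml ltr_normr => {small} /andP[].
  have [u0|u0] := leP u 0; rewrite ?(ler0_norm u0) ?(gtr0_norm u0) => h1 h2.
    have w0 : u + v < 0 by lra.
    by rewrite ltNge ltW //= lt_eqF.
  have w0 : 0 < u + v by lra.
  by rewrite w0 gt_eqF.
have sgn_z t i : (i < N)%N -> (0 < power_sum s a b (cs t) (z i)) = ~~ t /\
    power_sum s a b (cs t) (z i) != 0.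
  move=> iN; rewrite csE fz // add0r -mulrA; have e0 : 0 < eps * g (z i) by rewrite mulr_gt0.
  case: t; rewrite ?expr1 ?expr0 ?mulN1r ?mul1r.
    by rewrite oppr_gt0 oppr_eq0 ltNge ltW //= gt_eqF.
  by rewrite e0 gt_eqF.
have step j : (j < N.*2)%N -> y j <= y j.+1.
  move=> jN; have := odd_double_half j; have iN : (j./2 < N)%N by lia.
  case: (odd j) => <-; rewrite ?add1n ?add0n.
    by rewrite -doubleS yO yE ltW //; have [] := pz _ iN.
  by rewrite yO yE ltW //; have [] := pz _ iN.
have ymono i j : (i <= j)%N -> (j <= N.*2)%N -> y i <= y j.
  move=> ij; rewrite -(subnKC ij); elim: (j - i)%N => [|d IH]; first by rewrite addn0.
  by rewrite addnS => dN; apply: le_trans (IH (ltnW dN)) (step _ dN).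
have bound t : (\sum_(i < N) (((0 < f (p i))%R != ~~ t) + (~~ t != (0 < f (p i.+1))%R))
    <= 2 * m.-1)%N.
  have := @distinct_charges_sign_changes R s 'I_m a b (cs t) s_ge b_gt0 (cs0 t) centres_inj N.*2 y ymono.
  rewrite card_ord (sum_double N (fun j => nat_of_bool
    ((0 < power_sum s a b (cs t) (y j))%R != (0 < power_sum s a b (cs t) (y j.+1))%R))).
  move=> H; apply: leq_trans (H _).
    apply: leq_sum => i _; rewrite -doubleS yE yO yE.
    have [-> _] := sgn_p t i (ltnW (ltn_ord i)); have [-> _] := sgn_p t i.+1 (ltn_ord i).
    by have [-> _] := sgn_z t i (ltn_ord i).
  move=> j jN; rewrite /y; have := odd_double_half j; case: (odd j) => e.
    by have [] := sgn_z t j./2; first lia.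
  by have [] := sgn_p t j./2; first lia.
have := leq_add (bound true) (bound false); rewrite -big_split /=.
rewrite (eq_bigr (fun=> 2%N)); last first.
  by move=> i _; case: (0 < f (p i)); case: (0 < f (p i.+1)).
by rewrite sum_nat_const card_ord; lia.
Qed.

End CountingZeros.

Theorem theorem1p2 (R : realType) (n : nat) (a b c : 'I_n -> R) (alpha : R)
  (n_ge1 : (1 <= n)%N)
  (b_neq0 : forall k, b k != 0)
  (alpha_le : alpha <= - (1 / 2))
  (f_not_zero : ~ (forall x : R, quadratic_power_sum a b c alpha x = 0)) :
  ([set x : R | quadratic_power_sum a b c alpha x = 0]
     #<= `I_(2 * (n - 1)))%card.
Proof.
apply: contrapT => /uniq_points_of_card[l [luniq lsize lzero]].
have s_ge : 1 / 2 <= - alpha by lra.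
have [m [a' [b' [c' [mn b'0 c'0 inj' fE]]]]] := merge_charges a c alpha b_neq0.
have m0 : (0 < m)%N.
  rewrite lt0n; apply/eqP => m0; apply: f_not_zero => x; rewrite fE /power_sum.
  by apply: big1 => -[k km] _; exfalso; rewrite m0 in km.
set N := (2 * (n - 1)).+1 in lsize.
pose z i := nth 0 (sort <=%R l) i.
have zsize : size (sort <=%R l) = N by rewrite size_sort.
have zlt i : (i.+1 < N)%N -> z i < z i.+1.
  move=> iN; have : sorted <%R (sort <=%R l).
    by rewrite lt_sorted_uniq_le sort_uniq luniq sort_le_sorted.
  by move/(sortedP 0)/(_ i); apply; rewrite zsize.
have z0 i : (i < N)%N -> quadratic_power_sum a b c alpha (z i) = 0.
  by move=> iN; apply: lzero; rewrite -(mem_sort <=%R) mem_nth // zsize.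
have /choice[p pP] : forall i, exists q,
    [/\ ((i < N)%N -> q < z i), ((0 < i <= N)%N -> z i.-1 < q) &
        quadratic_power_sum a b c alpha q != 0].
  (* The interval between consecutive zeros, with an artificial end below the
     first and above the last one. *)
  move=> i; pose lo := if i is i'.+1 then z i' else z 0%N - 1.
  pose hi := if (i < N)%N then z i else lo + 1.
  have lohi : lo < hi.
    rewrite /hi; case: ifP => [iN|_]; last by rewrite ltrDl.
    by rewrite /lo; case: (i) iN => [|j] jN; [rewrite gtrDl ltrN10|exact: zlt].
  apply: contrapT => none; apply: f_not_zero.
  apply: (power_sum_unique_continuation b_neq0 lohi) => x /andP[lox xhi].
  apply: contrapT => fx; apply: none; exists x; split; last exact/eqP.
  - by move=> iN; move: xhi; rewrite /hi iN.
  - by move=> /andP[i0 _]; move: lox; rewrite /lo; case: (i) i0.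
have : (N <= 2 * m.-1)%N.
  apply: (@interlaced_zeros_bound R (- alpha) m a' b' c' s_ge b'0 c'0 inj' N z p m0).
  - move=> i iN; have [pi1 _ _] := pP i; have [_ pi2 _] := pP i.+1.
    by split; [exact: pi1|exact: pi2].
  - by move=> i iN; rewrite -fE z0.
  - by move=> i _; rewrite -fE; have [_ _] := pP i.
by rewrite /N; move: mn n_ge1 m0; lia.
Qed.
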